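(* Let $0<2\alpha<\beta\le1$, $h\in\text{H\''ol}_\beta(X,d)$ and define $p(\alpha,\beta):=\ell\,d_f(\beta-2\alpha)^{-1}$ with $\ell=\lceil d_f\beta^{-1}\rceil+1$. Then for every $p\ge1$ with $p>p(\alpha,\beta)$ it holds that $\mathrm K_{\alpha,h}\in\mathcal S_p(L^2(X,\mu))$ with $$\|\mathrm K_{\alpha,h}\|_{\mathcal S_p}\le C\,\text{H\''ol}_\beta(h),$$ where $C>0$ does not depend on $h$. Moreover, if $d_f(\beta-2\alpha)^{-1}\ge2$, the same holds with $\ell=1$, i.e. with $p(\alpha,\beta)=d_f(\beta-2\alpha)^{-1}$.
   Context: $(X,d)$ is a compact metric space and $\mu$ is a finite Borel measure on $X$ that is Ahlfors $d_f$-regular for some $d_f>0$: there is $C\ge 1$ with $C^{-1}r^{d_f}\le \mu(\overline B(x,r))\le Cr^{d_f}$ for all $x\in X$ and $0\le r<\operatorname{diam}X$. Functions are real-valued and Hilbert spaces are real. $\text{H\''ol}_\beta(X,d)$ is the space of $\beta$-H\''older functions, and $\text{H\''ol}_\beta(h)$ is the smallest number with $|h(x)-h(y)|\le\text{H\''ol}_\beta(h)d(x,y)^\beta$ for all $x,y\in X$. $\mathrm K_{\alpha,h}:L^2(X,\mu)\to L^2(X,\mu)$ is the bounded integral operator $\mathrm K_{\alpha,h}f(x)=\int_X\frac{h(x)-h(y)}{d(x,y)^{d_f+2\alpha}}f(y)\,d\mu(y)$. $\mathcal S_p$ ($p\ge1$) is the Schatten $p$-ideal with norm $\|T\|_{\mathcal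 S_p}=\|(s_n(T))_n\|_{\ell^p}$, $s_n(T)$ the singular values. *)

(* Defs.v *)
From HB Require Import structures.
From mathcomp Require Import all_boot all_order all_algebra.
From mathcomp Require Import all_classical all_reals all_analysis.
From mathcomp Require Import ess_sup_inf measurable_realfun.
Set Implicit Arguments.
Unset Strict Implicit.
Unset Printing Implicit Defensive.
Import Order.TTheory GRing.Theory Num.Theory.
Import numFieldNormedType.Exports.
Local Open Scope classical_set_scope.
Local Open Scope ring_scope.

(* [measurableType] requires a point, hence so does a metric space carrying a
   Borel measure. *)
#[short(type="pointedMetricType")]
HB.structure Definition PointedMetric (K : numDomainType) :=
  {M of Pointed M & Metric K M}.

Notation borelType X := (g_sigma_algebraType (@open X)).

(* [LspaceType mu p1] is the library's quotient of the p-integrable functions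
   by almost everywhere equality; the library gives it no algebraic structure.
   It is made here a normed space for the norm 'N[mu]_p. *)
Section Lspace_normed.
Context d (T : measurableType d) (R : realType).
Variables (mu : {measure set T -> \bar R}) (p : \bar R) (p1 : (1 <= p)%E).
Local Notation Lp := (LspaceType mu p1).
Local Notation lfun := (LfunType mu p1).

HB.instance Definition _ := gen_eqMixin Lp.
HB.instance Definition _ := gen_choiceMixin Lp.

Local Open Scope quotient_scope.

Local Notation mquot := {mfun_ mu, T >-> measurableTypeR R}.

Lemma eq_ae_Lnorm (f g : T -> R) : measurable_fun setT f ->
  measurable_fun setT g -> f = g %[ae mu] ->
  ('N[mu]_p[EFin \o f] = 'N[mu]_p[EFin \o g])%E.
Proof.
move=> mf mg fg; rewrite unlock /Lnorm; case: p p1 => [r r1|_|//].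
  congr (_ `^ _)%E; apply: ae_eq_integral => //.
  - apply/measurable_EFinP; apply: (@measurableT_comp _ _ _ _ _ _ (@powR R ^~ r)) => //.
    exact: measurableT_comp.
  - apply/measurable_EFinP; apply: (@measurableT_comp _ _ _ _ _ _ (@powR R ^~ r)) => //.
    exact: measurableT_comp.
  - by apply: filterS fg => x fg _ /=; rewrite fg.
by case: ifPn => // _; apply: eq_ess_sup; apply: filterS fg => x fg /=; rewrite fg.
Qed.

(* The measurable structures of [R] and of [measurableTypeR R] are convertible,
   but unification does not see it. *)
Section class_of_function.
Variable f : lfun.
Let f' : T -> measurableTypeR R := f.
Let mf' : measurable_fun setT f'.
Proof. by move=> _ A mA; exact: (@measurable_funPT _ _ _ _ f). Qed.
#[local] HB.instance Definition _ := @isMeasurableFun.Build _ _ _ _ f' mf'.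

Let c : mquot := \pi_mquot (f' : {mfun T >-> measurableTypeR R}).

Let c_ae : (c : T -> R) = f %[ae mu].
Proof.
have : \pi_mquot (repr c) = c by rewrite reprK.
by move=> /eqP; rewrite eqmodE => /asboolP.
Qed.

Let c_fin : finite_norm mu p c.
Proof.
rewrite /finite_norm (@eq_ae_Lnorm c f) //.
  exact: Lfunction_finite.
by move=> _ A mA; exact: (@measurable_funPT _ _ _ _ (repr c)).
Qed.
#[local] HB.instance Definition _ := isFinLebesgue.Build _ _ _ mu p p1 c c_fin.

Definition Lclass : Lp := c.

Lemma Lclass_ae : (Lclass : T -> R) = f %[ae mu].
Proof. exact: c_ae. Qed.
End class_of_function.

Section representative.
Variable f : Lp.
Let f' : T -> R := f.
Let mf' : measurable_fun setT f'.
Proof.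
by move=> _ A mA; exact: (@measurable_funPT _ _ _ _ (repr (f : mquot))).
Qed.
#[local] HB.instance Definition _ := @isMeasurableFun.Build _ _ _ _ f' mf'.
#[local] HB.instance Definition _ :=
  isLfunction.Build _ _ _ mu p p1 f' (@Lebesgue_finite _ _ _ _ _ _ f).
Definition Lrepr : lfun := f'.

Lemma LreprE : (Lrepr : T -> R) = f. Proof. by []. Qed.
End representative.

Lemma Lspace_eqP (f g : Lp) : (f : T -> R) = g %[ae mu] <-> f = g.
Proof.
split=> [fg|-> //]; last exact: nearW.
have : (f : mquot) = g.
  by rewrite -[LHS]reprK -[RHS]reprK; apply/eqP; rewrite eqmodE; exact/asboolP.
case: f g {fg} => [f [[pf]]] [g [[pg]]] /= fg.
by subst g; rewrite (Prop_irrelevance pf pg).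
Qed.


Let zero : Lp := Lclass 0.
Let opp (f : Lp) : Lp := Lclass (- Lrepr f).
Let add (f g : Lp) : Lp := Lclass (Lrepr f + Lrepr g).
Let scale (a : R) (f : Lp) : Lp := Lclass (a *: Lrepr f).

Let zeroE : (zero : T -> R) = (fun=> 0) %[ae mu].
Proof. exact: Lclass_ae. Qed.
Let oppE f : (opp f : T -> R) = (fun x => - f x) %[ae mu].
Proof. exact: Lclass_ae. Qed.
Let addE f g : (add f g : T -> R) = (fun x => f x + g x) %[ae mu].
Proof. exact: Lclass_ae. Qed.
Let scaleE a f : (scale a f : T -> R) = (fun x => a * f x) %[ae mu].
Proof. exact: Lclass_ae. Qed.

Let addA : associative add.
Proof.
move=> f g h; apply/Lspace_eqP.
near=> x => _; rewrite (near (addE f (add g h)) x)// (near (addE g h) x)//.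
by rewrite (near (addE (add f g) h) x)// (near (addE f g) x)// addrA.
Unshelve. all: by end_near. Qed.

Let addC : commutative add.
Proof.
move=> f g; apply/Lspace_eqP; near=> x => _.
by rewrite (near (addE f g) x)// (near (addE g f) x)// addrC.
Unshelve. all: by end_near. Qed.

Let add0 : left_id zero add.
Proof.
move=> f; apply/Lspace_eqP; near=> x => _.
by rewrite (near (addE zero f) x)// (near zeroE x)// add0r.
Unshelve. all: by end_near. Qed.

Let addN : left_inverse zero opp add.
Proof.
move=> f; apply/Lspace_eqP; near=> x => _.
rewrite (near (addE (opp f) f) x)// (near zeroE x)// (near (oppE f) x)//.
by rewrite addNr.
Unshelve. all: by end_near. Qed.

HB.instance Definition _ := GRing.isZmodule.Build Lp addA addC add0 addN.

Let scaleA a b f : scale a (scale b f) = scale (a * b) f.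
Proof.
apply/Lspace_eqP; near=> x => _.
rewrite (near (scaleE a (scale b f)) x)// (near (scaleE b f) x)//.
by rewrite (near (scaleE (a * b) f) x)// mulrA.
Unshelve. all: by end_near. Qed.

Let scale1 : left_id 1 scale.
Proof.
move=> f; apply/Lspace_eqP; near=> x => _.
by rewrite (near (scaleE 1 f) x)// mul1r.
Unshelve. all: by end_near. Qed.

Let scaleDr : right_distributive scale +%R.
Proof.
move=> a f g; apply/Lspace_eqP; near=> x => _.
rewrite (near (scaleE a (f + g)) x)// (near (addE f g) x)//.
rewrite (near (addE (scale a f) (scale a g)) x)//.
by rewrite (near (scaleE a f) x)// (near (scaleE a g) x)// mulrDr.
Unshelve. all: by end_near. Qed.

Let scaleDl f : {morph scale^~ f : a b / a + b}.
Proof.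
move=> a b; apply/Lspace_eqP; near=> x => _.
rewrite (near (scaleE (a + b) f) x)//.
rewrite (near (addE (scale a f) (scale b f)) x)//.
by rewrite (near (scaleE a f) x)// (near (scaleE b f) x)// mulrDl.
Unshelve. all: by end_near. Qed.

HB.instance Definition _ :=
  GRing.Zmodule_isLmodule.Build R Lp scaleA scale1 scaleDr scaleDl.

Lemma Lspace0E : ((0 : Lp) : T -> R) = (fun=> 0) %[ae mu].
Proof. exact: zeroE. Qed.
Lemma LspaceNE (f : Lp) : (- f : T -> R) = (fun x => - f x) %[ae mu].
Proof. exact: oppE. Qed.
Lemma LspaceDE (f g : Lp) : (f + g : T -> R) = (fun x => f x + g x) %[ae mu].
Proof. exact: addE. Qed.
Lemma LspaceZE a (f : Lp) : (a *: f : T -> R) = (fun x => a * f x) %[ae mu].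
Proof. exact: scaleE. Qed.

Let norm (f : Lp) : R := fine 'N[mu]_p[EFin \o (f : T -> R)]%E.

Let norm_class (f : lfun) : norm (Lclass f) = fine 'N[mu]_p[EFin \o f]%E.
Proof.
rewrite /norm; congr fine; apply: eq_ae_Lnorm => //; last exact: Lclass_ae.
exact: (@measurable_funPT _ _ _ _ (Lrepr (Lclass f))).
Qed.

Let norm_triangle (f g : Lp) : norm (f + g) <= norm f + norm g.
Proof. by rewrite norm_class; exact: (ler_LnormD (Lrepr f) (Lrepr g)). Qed.

Let normZ a (f : Lp) : norm (a *: f) = `|a| * norm f.
Proof.
rewrite norm_class; apply: EFin_inj; rewrite EFinM.
rewrite !(finite_norm_fine (a *: Lrepr f)) -[norm f]/(fine 'N[mu]_p[EFin \o Lrepr f]%E).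
by rewrite (finite_norm_fine (Lrepr f)) -LnormZ.
Qed.

Let norm_eq0 (f : Lp) : norm f = 0 -> f = 0.
Proof.
move=> /(@fine_Lnormr_eq0 _ _ _ mu p p1 (Lrepr f)) f0.
apply/Lspace_eqP; near=> x => _.
by rewrite (near Lspace0E x)//; exact: (near f0 x).
Unshelve. all: by end_near. Qed.

HB.instance Definition _ :=
  Lmodule_isNormed.Build R Lp norm_triangle normZ norm_eq0.

Lemma Lspace_normE (f : Lp) : `|f| = fine 'N[mu]_p[EFin \o (f : T -> R)]%E.
Proof. by []. Qed.

End Lspace_normed.

Notation L2 mu := (LspaceType mu (lee1n 2)).

Section schatten.
Context d (T : measurableType d) (R : realType).
Variable mu : {measure set T -> \bar R}.
Local Notation H := (L2 mu).

Definition dotL2 (f g : H) : R := \int[mu]_x (f x * g x).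

Definition compact_operator (A : H -> H) :=
  linear A /\ compact (closure (A @` [set f | `|f| <= 1])).

Definition adjoint (A : H -> H) : H -> H :=
  xget (fun=> 0) [set B | forall f g, dotL2 (A f) g = dotL2 f (B g)].

Definition orthonormal_family n (u : 'I_n -> H) :=
  forall i j, dotL2 (u i) (u j) = (i == j)%:R.

(* The singular values of a compact operator [A] are the square roots of the
   eigenvalues of [A^* A], enumerated in decreasing order with multiplicity, the
   enumeration being continued by 0. The eigenspaces of [A^* A] are pairwise
   orthogonal: the [n]-th singular value (from [n = 0]) is at least [t > 0] iff
   there are [n.+1] orthonormal eigenvectors with eigenvalues at least [t ^+ 2].
   This is meaningful only if [A] is compact. *)
Definition singular_value (A : H -> H) (n : nat) : R :=
  sup [set t | t = 0 \/
    0 < t /\ exists u : 'I_n.+1 -> H, orthonormal_family u /\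
      forall i, exists2 s, t <= s & adjoint A (A (u i)) = s ^+ 2 *: u i].

Definition schatten_norm (p : R) (A : H -> H) : \bar R :=
  ('N[counting]_(p%:E)[EFin \o singular_value A])%E.

Definition in_schatten (p : R) (A : H -> H) :=
  compact_operator A /\ (schatten_norm p A < +oo)%E.

(* The integral operator with kernel [k]; a function whose image is not square
   integrable is sent to 0. *)
Definition integral_operator (k : T -> T -> R) (f : H) : H :=
  Lclass (insubd 0 (fun x => \int[mu]_y (k x y * f y))).

End schatten.

Section metric.
Context (R : realType) (X : pointedMetricType R).

Definition diam : R := sup [set mdist x y | x in [set: X] & y in [set: X]].

(* Not [closed_ball], which is the closure of the open ball. *)
Definition mclosed_ball (x : X) (r : R) : set X := [set y | mdist x y <= r].

Definition ahlfors_regular (mu : {measure set (borelType X) -> \bar R})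
    (df : R) :=
  exists2 C : R, 1 <= C & forall (x : X) (r : R), 0 <= r < diam ->
    ((C^-1 * r `^ df)%:E <= mu (mclosed_ball x r) <= (C * r `^ df)%:E)%E.

Definition holder_bounds (beta : R) (h : X -> R) : set R :=
  [set L | 0 <= L /\ forall x y, `|h x - h y| <= L * mdist x y `^ beta].

Definition holder (beta : R) (h : X -> R) := holder_bounds beta h !=set0.

Definition holder_const (beta : R) (h : X -> R) : R :=
  inf (holder_bounds beta h).

(* On the diagonal this is 0 / 0 = 0. *)
Definition K_kernel (df alpha : R) (h : X -> R) (x y : X) : R :=
  (h x - h y) / mdist x y `^ (df + 2 * alpha).

Definition K_operator (mu : {measure set (borelType X) -> \bar R})
    (df alpha : R) (h : X -> R) : L2 mu -> L2 mu :=
  integral_operator (T := borelType X) (K_kernel df alpha h).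

End metric.

Arguments diam {R} X.
Arguments K_operator {R X} mu df alpha h.

Definition schatten_exponent (R : realType) (l : int) (df alpha beta : R) : R :=
  l%:~R * df * (beta - 2 * alpha)^-1.

(* Main.v *)
Require Import Defs.
From HB Require Import structures.
From mathcomp Require Import finmap.
From mathcomp Require Import all_boot all_order all_algebra.
From mathcomp Require Import all_classical all_reals all_analysis.
From mathcomp Require Import measurable_realfun ring lra.
Set Implicit Arguments.
Unset Strict Implicit.
Unset Printing Implicit Defensive.
Import Order.TTheory GRing.Theory Num.Theory.
Import numFieldNormedType.Exports.
Local Open Scope classical_set_scope.
Local Open Scope ring_scope.

(* Write [K] for the operator, [k] for its kernel, [gamma = beta - 2 * alpha] and
   [L] for a Hoelder bound of [h], so that [|k x y| <= L * d(x, y)^(gamma - df)].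
   The singular values of [K] are estimated one by one, by splitting [k] into a
   kernel of small Schur norm, a kernel of small Hilbert-Schmidt norm and a kernel
   of finite rank; this avoids interpolation theorems for Schatten ideals.

   If [p > 2] and [p > df / gamma], one may lower [gamma] to some [g < df / 2]
   with [p > df / g]. Truncate [k] at the scale [delta], replacing [d(x, y)] in the
   denominator by [max (d(x, y), delta)]: by regularity the truncated kernel has
   squared Hilbert-Schmidt norm [O(delta^(2 g - df))] and the rest has Schur norm
   [O(delta^g)]. With [delta = (n + 1)^(-1 / df)] the [n]-th singular value is
   [O((n + 1)^(-g / df))], a sequence of [l^p].

   If [p <= 2] then [p > 2 df / gamma] forces [df < gamma]: the kernel is bounded
   and Hoelder continuous of exponent [gamma - df]. Replacing it by a function
   which is constant in [x] on each of at most [(n + 1) / 2] cells of radius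
   [r ~ (n + 1)^(-1 / df)] costs [O(r^(gamma - df))] uniformly, so the [n]-th
   singular value is [O((n + 1)^(- (gamma - df) / df - 1 / 2))], which is again a
   sequence of [l^p].

   The same splitting approximates [K] by finite rank operators in operator norm,
   which gives compactness as soon as [L2 mu] is known to be complete. *)

(** * Bessel's inequality and singular values *)

Section inner_product.
Context d (T : measurableType d) (R : realType).
Variable mu : {measure set T -> \bar R}.
Local Notation H := (L2 mu).
Implicit Types f g : H.

Lemma L2_measurable f : measurable_fun setT (f : T -> R).
Proof. by move=> _ A mA; exact: (@measurable_funPT _ _ _ _ (Lrepr f)). Qed.

Lemma L2_Lfun f : (f : T -> R) \in Lfun mu 2%:E.
Proof. exact: (LfunP (Lrepr f)). Qed.

Lemma L2_integrableM f g : mu.-integrable setT (EFin \o (fun x => f x * g x)).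
Proof.
by apply/Lfun1_integrable; apply: Lfun2_mul_Lfun1; exact: L2_Lfun.
Qed.

Lemma dotL2E f g : (dotL2 f g)%:E = (\int[mu]_x (f x * g x)%:E)%E.
Proof.
by rewrite /dotL2 /Rintegral fineK//; exact: integrable_fin_num (L2_integrableM f g).
Qed.

Lemma eq_ae_Rintegral (u v : T -> R) :
  measurable_fun setT u -> measurable_fun setT v ->
  u = v %[ae mu] -> \int[mu]_x u x = \int[mu]_x v x.
Proof.
move=> mu' mv uv; rewrite /Rintegral; congr fine; apply: ae_eq_integral => //.
- exact/measurable_EFinP.
- exact/measurable_EFinP.
- by apply: filterS uv => x /= + _ => ->.
Qed.

Lemma dotC f g : dotL2 f g = dotL2 g f.
Proof. by apply: eq_Rintegral => x _; rewrite mulrC. Qed.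

Lemma dotDl f1 f2 g : dotL2 (f1 + f2) g = dotL2 f1 g + dotL2 f2 g.
Proof.
rewrite /dotL2 -RintegralD//; [|exact: L2_integrableM..].
apply: eq_ae_Rintegral.
- by apply: measurable_funM; exact: L2_measurable.
- by apply: measurable_funD; apply: measurable_funM; exact: L2_measurable.
- by apply: filterS (LspaceDE f1 f2) => x /= -> //; rewrite mulrDl.
Qed.

Lemma dotZl a f g : dotL2 (a *: f) g = a * dotL2 f g.
Proof.
rewrite /dotL2 -RintegralZl//; last exact: L2_integrableM.
apply: eq_ae_Rintegral.
- by apply: measurable_funM; exact: L2_measurable.
- by do 2 (apply: measurable_funM => //); exact: L2_measurable.
- by apply: filterS (LspaceZE a f) => x /= -> //; rewrite mulrA.
Qed.

Lemma dotZr a f g : dotL2 f (a *: g) = a * dotL2 f g.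
Proof. by rewrite dotC dotZl dotC. Qed.

Lemma dot0l g : dotL2 0 g = 0.
Proof. by rewrite -(scale0r (0 : H)) dotZl mul0r. Qed.

Lemma dot0r g : dotL2 g 0 = 0.
Proof. by rewrite dotC dot0l. Qed.

Lemma dotNl f g : dotL2 (- f) g = - dotL2 f g.
Proof. by rewrite -scaleN1r dotZl mulN1r. Qed.

Lemma dotBl f1 f2 g : dotL2 (f1 - f2) g = dotL2 f1 g - dotL2 f2 g.
Proof. by rewrite dotDl dotNl. Qed.

Lemma dotBr f g1 g2 : dotL2 f (g1 - g2) = dotL2 f g1 - dotL2 f g2.
Proof. by rewrite dotC dotBl !(dotC f). Qed.

Lemma dot_suml (I : Type) (r : seq I) (F : I -> H) g :
  dotL2 (\sum_(i <- r) F i) g = \sum_(i <- r) dotL2 (F i) g.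
Proof.
elim: r => [|i r ih]; first by rewrite !big_nil dot0l.
by rewrite !big_cons dotDl ih.
Qed.

Lemma dot_sumr (I : Type) (r : seq I) (F : I -> H) g :
  dotL2 g (\sum_(i <- r) F i) = \sum_(i <- r) dotL2 g (F i).
Proof. by rewrite dotC dot_suml; apply: eq_bigr => i _; rewrite dotC. Qed.

Lemma dot_ge0 f : 0 <= dotL2 f f.
Proof. by apply: Rintegral_ge0 => x _; rewrite -expr2 sqr_ge0. Qed.

Lemma Lnorm2_sqr (u : T -> R) : measurable_fun setT u ->
  ('N[mu]_2%:E[EFin \o u] `^ 2 = \int[mu]_x (u x ^+ 2)%:E)%E.
Proof.
move=> mu'; rewrite powR_Lnorm//; apply: eq_integral => x _ /=.
by rewrite powR_mulrn// real_normK// num_real.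
Qed.

Lemma normL2_sqr f : `|f| ^+ 2 = dotL2 f f.
Proof.
apply: EFin_inj; rewrite dotL2E.
under eq_integral do rewrite -expr2.
rewrite -Lnorm2_sqr; last exact: L2_measurable.
rewrite Lspace_normE -[in RHS](@fineK _ 'N[mu]_2%:E[EFin \o (f : T -> R)]%E).
  by rewrite poweR_EFin powR_mulrn// fine_ge0// Lnorm_ge0.
rewrite ge0_fin_numE ?Lnorm_ge0//.
exact: Lfunction_finite (Lrepr f).
Qed.

Lemma dot_le_normM f g : `|dotL2 f g| <= `|f| * `|g|.
Proof.
rewrite -ler_sqr ?nnegrE ?mulr_ge0// exprMn !normL2_sqr real_normK ?num_real//.
have [g0|g0] := eqVneq (dotL2 g g) 0.
  suff -> : dotL2 f g = 0 by rewrite expr0n/= mulr_ge0// dot_ge0.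
  have : `|g| ^+ 2 = 0 by rewrite normL2_sqr.
  by move/eqP; rewrite sqrf_eq0 normr_eq0 => /eqP ->; rewrite dot0r.
have gp : 0 < dotL2 g g by rewrite lt_def g0 dot_ge0.
(* This vector is [|g|^2] times the component of [f] orthogonal to [g]; its squared norm is
   [|g|^2 (|f|^2 |g|^2 - <f, g>^2)]. *)
have := dot_ge0 (dotL2 g g *: f - dotL2 f g *: g).
rewrite !(dotBl, dotBr, dotZl, dotZr) (dotC g f).
set a := dotL2 f f; set b := dotL2 f g; set c := dotL2 g g in gp *.
rewrite (_ : _ - _ = c * (a * c - b ^+ 2)); last by ring.
by rewrite pmulr_rge0// subr_ge0.
Qed.

End inner_product.

Section bessel.
Context d (T : measurableType d) (R : realType).
Variable mu : {measure set T -> \bar R}.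
Local Notation H := (L2 mu).

(* Orthogonal families of vectors of norm 1 or 0: the normalized indicators of
   the cells of a partition are such when some cells are null. *)
Definition partial_orthonormal n (e : 'I_n -> H) (b : 'I_n -> bool) :=
  forall i j, dotL2 (e i) (e j) = ((i == j) && b i)%:R.

Lemma orthonormal_partial n (u : 'I_n -> H) :
  orthonormal_family u -> partial_orthonormal u (fun=> true).
Proof. by move=> ou i j; rewrite ou andbT. Qed.

Section partial.
Variables (n : nat) (e : 'I_n -> H) (b : 'I_n -> bool).
Hypothesis oe : partial_orthonormal e b.

Lemma dot_partial_orthonormal0 g i : b i = false -> dotL2 g (e i) = 0.
Proof.
move=> bi; suff -> : e i = 0 by rewrite dot0r.
apply/eqP; rewrite -normr_eq0 -sqrf_eq0; apply/eqP.
by rewrite normL2_sqr oe bi andbF.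
Qed.

(** Completing the square in each coefficient. The factor [b j] is there because the coefficient of
    a zero vector [e j] does not affect the distance. *)
Lemma dist_span g (c : 'I_n -> R) :
  `|g - \sum_j c j *: e j| ^+ 2 =
  dotL2 g g - \sum_j dotL2 g (e j) ^+ 2
  + \sum_j (b j)%:R * (c j - dotL2 g (e j)) ^+ 2.
Proof.
rewrite normL2_sqr dotBl !dotBr !dot_suml !dot_sumr.
have -> : \sum_i dotL2 (c i *: e i) (\sum_j c j *: e j) =
          \sum_i (b i)%:R * c i ^+ 2.
  apply: eq_bigr => i _; rewrite dot_sumr (bigD1 i)//= big1 ?addr0.
    by rewrite dotZl dotZr oe eqxx/=; ring.
  by move=> j ji; rewrite dotZl dotZr oe eq_sym (negbTE ji) !mulr0.
rewrite -!addrA; congr (_ + _); rewrite -?sumrN -?big_split/= -?sumrN -?big_split/=.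
apply: eq_bigr => i _; rewrite !(dotZl, dotZr) (dotC (e i)).
case: (boolP (b i)) => bi /=; first by ring.
by rewrite dot_partial_orthonormal0 ?(negbTE bi)//; ring.
Qed.

Lemma bessel g : \sum_j dotL2 g (e j) ^+ 2 <= dotL2 g g.
Proof.
rewrite -subr_ge0.
have <- : `|g - \sum_j dotL2 g (e j) *: e j| ^+ 2 =
    dotL2 g g - \sum_j dotL2 g (e j) ^+ 2.
  by rewrite dist_span [X in _ + X]big1 ?addr0// => j _; rewrite subrr expr0n/= mulr0.
exact: sqr_ge0.
Qed.

Lemma dist_span_ge g (c : 'I_n -> R) :
  dotL2 g g - \sum_j dotL2 g (e j) ^+ 2 <= `|g - \sum_j c j *: e j| ^+ 2.
Proof.
by rewrite dist_span lerDl sumr_ge0// => j _; rewrite mulr_ge0// sqr_ge0.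
Qed.

End partial.

(* Only the upper bound of the singular values is needed, so the existence of
   the adjoint is not: without it, [adjoint A] is the junk value 0, which has no
   positive eigenvalue. *)
Lemma singular_value_adjoint (A : H -> H) n (t : R) (u : 'I_n.+1 -> H) :
  0 < t -> orthonormal_family u ->
  (forall i, exists2 s : R, t <= s & adjoint A (A (u i)) = s ^+ 2 *: u i) ->
  forall f g, dotL2 (A f) g = dotL2 f (adjoint A g).
Proof.
move=> t0 ou Au; rewrite /adjoint; set P := [set B | _].
case: (pselect (exists B, P B)) => [[B PB]|noB].
  exact: (xgetI (fun=> 0) PB).
have [s ts] := Au ord0; rewrite /adjoint xgetPN; last first.
  by move=> B PB; apply: noB; exists B.
move=> /(congr1 (fun g => dotL2 g (u ord0))).
rewrite dot0l dotZl ou eqxx mulr1 => /esym/eqP.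
by rewrite sqrf_eq0 gt_eqF// (lt_le_trans t0).
Qed.

(** A summed form of the min-max principle. The normalized images of the [u i] are orthonormal, so
    by Bessel's inequality their squared projections onto the span of [e] add up to at most [N].
    What remains, at least [n + 1 - N], is scaled by factors at least [t ^+ 2]. Working with the sum
    over [i] lets Hilbert-Schmidt bounds enter directly. *)
Lemma singular_value_sum_dist (A : H -> H) n (t : R) (u : 'I_n.+1 -> H)
    N (e : 'I_N -> H) (b : 'I_N -> bool) (c : 'I_n.+1 -> 'I_N -> R) :
  0 < t -> orthonormal_family u ->
  (forall i, exists2 s : R, t <= s & adjoint A (A (u i)) = s ^+ 2 *: u i) ->
  partial_orthonormal e b ->
  t ^+ 2 * (n.+1%:R - N%:R) <=
  \sum_i `|A (u i) - \sum_j c i j *: e j| ^+ 2.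
Proof.
move=> t0 ou Au oe.
have adjP := singular_value_adjoint t0 ou Au.
have /choice[s sP] i : exists s : R, t <= s /\ adjoint A (A (u i)) = s ^+ 2 *: u i.
  by have [s ? ?] := Au i; exists s.
have s0 i : 0 < s i by rewrite (lt_le_trans t0)//; case: (sP i).
(* These are orthonormal because [<A u_i, A u_j> = <u_i, adjoint A (A u_j)> = s_j^2 <u_i, u_j>]. *)
pose v i := (s i)^-1 *: A (u i).
have ov : orthonormal_family v.
  move=> i j; rewrite dotZl dotZr adjP (sP j).2 dotZr ou.
  case: eqVneq => [->|_]; last by rewrite !mulr0.
  rewrite mulr1 /=; have := s0 j; move: (s j) => r r0. by field; rewrite gt_eqF.
have Auv i : A (u i) = s i *: v i by rewrite scalerA divff ?gt_eqF// scale1r.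
apply: (@le_trans _ _ (\sum_i (s i ^+ 2 * (1 - \sum_j dotL2 (v i) (e j) ^+ 2)))).
  apply: (@le_trans _ _ (\sum_i (t ^+ 2 * (1 - \sum_j dotL2 (v i) (e j) ^+ 2)))).
    rewrite -mulr_sumr ler_wpM2l ?sqr_ge0// sumrB sumr_const card_ord lerD2l.
    rewrite lerN2 exchange_big/= -[in leRHS](card_ord N) -sumr_const ler_sum// => j _.
    apply: (@le_trans _ _ (dotL2 (e j) (e j))); last by rewrite oe eqxx; case: (b j).
    apply: le_trans (bessel (orthonormal_partial ov) (e j)).
    by apply: ler_sum => i _; rewrite dotC.
  (* Lowering [s i] to [t] requires the other factor to be nonnegative, which is Bessel's inequality
     for [e]. *)
  apply: ler_sum => i _; rewrite ler_wpM2r//.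
    by rewrite subr_ge0 (le_trans (bessel oe _))// ov eqxx.
  by case: (sP i) => ts _; apply: lerXn2r; rewrite ?nnegrE ?(ltW t0) ?(ltW (s0 i)).
apply: ler_sum => i _; apply: le_trans (dist_span_ge oe _ _).
rewrite Auv dotZl dotZr ov eqxx mulr1 mulrBr mulr1 lerD2l lerN2 mulr_sumr.
by apply: ler_sum => j _; rewrite dotZl exprMn.
Qed.

Lemma singular_value_le (A : H -> H) n (M : R) : 0 <= M ->
  (forall (t : R) (u : 'I_n.+1 -> H), 0 < t -> orthonormal_family u ->
    (forall i, exists2 s : R, t <= s & adjoint A (A (u i)) = s ^+ 2 *: u i) ->
    t <= M) ->
  0 <= singular_value A n <= M.
Proof.
move=> M0 tM; rewrite /singular_value; set S := [set t | _].
have ubS : ubound S M.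
  by move=> t [->//|[t0 [u [ou Au]]]]; exact: tM t0 ou Au.
have S0 : S 0 by left.
apply/andP; split; last by apply: ge_sup => //; exists 0.
by apply: ub_le_sup => //; exists M.
Qed.
End bessel.

(** * Integral operators with a Schur bound *)

Section integral_operator.
Context d (T : measurableType d) (R : realType).
Variable mu : {finite_measure set T -> \bar R}.
Local Notation H := (L2 mu).
Implicit Types (f g : H) (k : T -> T -> R).

Lemma integrable_square_Lfun2 (F : T -> R) : measurable_fun setT F ->
  (\int[mu]_x (F x ^+ 2)%:E < +oo)%E -> F \in Lfun mu 2%:E.
Proof.
move=> mF Foo; rewrite inE; apply/andP; split; rewrite inE//=.
by rewrite /finite_norm (@lty_poweRy _ _ 2)// Lnorm2_sqr.
Qed.

Lemma LclassK (F : T -> R) : F \in Lfun mu 2%:E ->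
  ((Lclass (insubd 0 F) : H) : T -> R) = F %[ae mu].
Proof.
move=> LF; have := Lclass_ae (insubd (0 : LfunType mu (lee1n 2)) F).
by apply: filterS => x /= -> //; have := insubdK (0 : LfunType mu (lee1n 2)) LF => ->.
Qed.

(** Hölder's inequality for the exponents 2 and 2, kept in the extended reals so that a finite
    right-hand side yields the integrability of the product. *)
Lemma cauchy_schwarz_integral (u v : T -> R) :
  measurable_fun setT u -> measurable_fun setT v ->
  ((\int[mu]_x `|u x * v x|%:E) `^ 2 <=
   \int[mu]_x (u x ^+ 2)%:E * \int[mu]_x (v x ^+ 2)%:E)%E.
Proof.
move=> mu' mv; rewrite -!Lnorm2_sqr// -poweRM ?Lnorm_ge0//.
apply: gt0_ler_poweR => //; rewrite ?in_itv/= ?leey ?andbT.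
- exact: integral_ge0.
- by rewrite mule_ge0 ?Lnorm_ge0.
have -> : (\int[mu]_x `|u x * v x|%:E = 'N[mu]_1[EFin \o (u \* v)%R])%E.
  by rewrite Lnorm1.
by apply: hoelder => //; rewrite [RHS]splitr !div1r.
Qed.

Definition jointly_measurable k :=
  measurable_fun setT (fun z : T * T => k z.1 z.2).

Lemma jointly_measurable1 k : jointly_measurable k ->
  forall x, measurable_fun setT (k x).
Proof. by move=> mk x; exact: (measurable_fun_pair2 x mk). Qed.

Lemma jointly_measurable2 k : jointly_measurable k ->
  forall y, measurable_fun setT (k ^~ y).
Proof. by move=> mk y; exact: (measurable_fun_pair1 y mk). Qed.

(** The assumptions of Schur's test, which bounds the operator norm by [a]. Joint measurability
    serves Fubini's theorem, and positivity allows [a] to be cancelled. *)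
Definition schur_bound k (a : R) := [/\ 0 < a, jointly_measurable k,
  forall x, (\int[mu]_y `|k x y|%:E <= a%:E)%E &
  forall y, (\int[mu]_x `|k x y|%:E <= a%:E)%E].

Section schur.
Variables (k : T -> T -> R) (a : R).
Hypothesis ka : schur_bound k a.
Let a0 : 0 < a. Proof. by case: ka. Qed.
Let mk : jointly_measurable k. Proof. by case: ka. Qed.

Let mkf f : measurable_fun setT (fun z : T * T => k z.1 z.2 * f z.2).
Proof.
apply: measurable_funM => //.
by apply: (measurableT_comp _ measurable_snd); exact: L2_measurable.
Qed.

(** By Tonelli, integrating the kernel in its first variable leaves [a |f|], which is integrable
    since L2 is contained in L1 for a finite measure. *)
Lemma schur_integrable_prod f :
  (mu \x mu)%E.-integrable setT (fun z : T * T => (k z.1 z.2 * f z.2)%:E).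
Proof.
apply/integrable21ltyP; first exact/measurable_EFinP.
have : mu.-integrable setT (EFin \o (f : T -> R)).
  apply/Lfun1_integrable; apply: Lfun_subset12; last exact: L2_Lfun.
  exact: fin_num_measure.
move=> /integrableP[mf foo].
apply: (@le_lt_trans _ _ (\int[mu]_y (a%:E * `|(f y)%:E|))%E); last first.
  rewrite ge0_integralZl_EFin//; [|exact: measurableT_comp|exact: ltW].
  by rewrite lte_mul_pinfty// lee_fin ltW.
apply: ge0_le_integral => //.
- by move=> y _; exact: integral_ge0.
- apply: (measurable_fun_fubini_tonelli_G
    (fun z : T * T => `|(k z.1 z.2 * f z.2)%:E|%E)) => //.
  by apply: measurableT_comp => //; exact/measurable_EFinP.
- by apply: measurable_funeM; exact: measurableT_comp.
- move=> y _ /=; under eq_integral do rewrite normrM EFinM.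
  rewrite ge0_integralZr//; last first.
    by do 2 apply: measurableT_comp => //; exact: jointly_measurable2.
  by rewrite lee_wpmul2r//; case: ka.
Qed.

Local Notation F f := (fun x => \int[mu]_y (k x y * f y)).

Lemma schur_measurable f : measurable_fun setT (F f).
Proof.
apply: (measurableT_comp (fine_measurable measurableT)).
exact: (measurable_fubini_F (schur_integrable_prod f)).
Qed.

(** Cauchy-Schwarz for [|k| |f| = |k|^(1/2) (|k|^(1/2) |f|)], followed by the row bound on the first
    factor. *)
Lemma schur_pointwise f x :
  ((F f x ^+ 2)%:E <= a%:E * \int[mu]_y (`|k x y| * f y ^+ 2)%:E)%E.
Proof.
have mkx := jointly_measurable1 mk x.
have mf := @L2_measurable _ _ _ mu f.
pose u y := `|k x y| `^ 2^-1.
have usq y : u y ^+ 2 = `|k x y| by rewrite /u powR12_sqrt// sqr_sqrtr.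
have u0 y : 0 <= u y by exact: powR_ge0.
have mu' : measurable_fun setT u.
  apply: (measurableT_comp (measurable_powR _)) => //.
  exact: measurableT_comp.
have mkfx : measurable_fun setT (fun y => k x y * f y) by exact: measurable_funM.
apply: (@le_trans _ _ ((\int[mu]_y `|u y * (u y * f y)|%:E) `^ 2)%E).
  rewrite (_ : \int[mu]_y _ = \int[mu]_y `|(k x y * f y)%:E|)%E; last first.
    apply: eq_integral => y _.
    by rewrite /= mulrA -expr2 usq !normrM normr_id.
  have mkfE : measurable_fun setT (fun y => (k x y * f y)%:E) by exact/measurable_EFinP.
  (* If the integral of [|k f|] is infinite, the right-hand side is [+oo], whatever value [fine]
     gives to the integral of [k f]. *)
  have := le_abse_integral mu measurableT mkfE.
  rewrite /Rintegral.
  move: (\int[mu]_y `|(k x y * f y)%:E|)%E (\int[mu]_y (k x y * f y)%:E)%E.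
  move=> [r| |] [s| |] //; rewrite ?lee_fin => rs.
  - rewrite [fine _]/= powR_mulrn ?(le_trans _ rs)//.
    by rewrite -real_normK ?num_real// ler_sqr ?nnegrE// (le_trans _ rs).
  - by rewrite poweRyr// leey.
  - by rewrite poweRyr// leey.
  - by rewrite poweRyr// leey.
apply: (le_trans (cauchy_schwarz_integral _ _)) => //.
  exact: measurable_funM.
under eq_integral do rewrite usq.
under [X in (_ * X)%E]eq_integral do rewrite exprMn usq.
rewrite lee_wpmul2r//; last by case: ka.
by apply: integral_ge0 => y _; rewrite lee_fin mulr_ge0// sqr_ge0.
Qed.

(** Integrate [schur_pointwise] in [x], exchange the integrals and apply the column bound: rows and
    columns contribute one factor [a] each. *)
Lemma schur_square f :
  (\int[mu]_x (F f x ^+ 2)%:E <= (a ^+ 2 * dotL2 f f)%:E)%E.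
Proof.
have mf := @L2_measurable _ _ _ mu f.
have mabs : measurable_fun setT (fun z : T * T => (`|k z.1 z.2| * f z.2 ^+ 2)%:E).
  apply/measurable_EFinP; apply: measurable_funM.
    exact: measurableT_comp.
  by apply: measurable_funX; exact: (measurableT_comp _ measurable_snd).
have abs0 z : (0 <= (`|k z.1 z.2| * f z.2 ^+ 2)%:E)%E.
  by rewrite lee_fin mulr_ge0// sqr_ge0.
apply: (@le_trans _ _ (\int[mu]_x (a%:E * \int[mu]_y (`|k x y| * f y ^+ 2)%:E))%E).
  apply: ge0_le_integral => //.
  - by move=> x _; rewrite lee_fin sqr_ge0.
  - by apply/measurable_EFinP; apply: measurable_funX; exact: schur_measurable.
  - by apply: measurable_funeM; exact: (measurable_fun_fubini_tonelli_F _ mabs abs0).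
  - by move=> x _; exact: schur_pointwise.
rewrite ge0_integralZl_EFin//; last 3 first.
- by move=> x _; apply: integral_ge0 => y _; exact: (abs0 (x, y)).
- exact: (measurable_fun_fubini_tonelli_F _ mabs abs0).
- exact: ltW.
rewrite (fubini_tonelli _ mabs abs0)/= expr2 -mulrA EFinM lee_pmul2l//.
apply: (@le_trans _ _ (\int[mu]_y (a%:E * (f y ^+ 2)%:E))%E).
  apply: ge0_le_integral => //.
  - by move=> y _; apply: integral_ge0 => x _; exact: (abs0 (x, y)).
  - exact: (measurable_fun_fubini_tonelli_G _ mabs abs0).
  - apply: measurable_funeM; apply/measurable_EFinP; exact: measurable_funX.
  - move=> y _; under eq_integral do rewrite EFinM.
    rewrite ge0_integralZr//; last 2 first.
    + apply/measurable_EFinP; apply: measurableT_comp => //.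
      exact: jointly_measurable2.
    + by rewrite lee_fin sqr_ge0.
    by rewrite lee_wpmul2r ?lee_fin ?sqr_ge0//; case: ka.
rewrite ge0_integralZl_EFin//; last 3 first.
- by move=> y _; rewrite lee_fin sqr_ge0.
- apply/measurable_EFinP; exact: measurable_funX.
- exact: ltW.
by rewrite EFinM dotL2E; under [in leRHS]eq_integral do rewrite -expr2.
Qed.

Lemma schur_Lfun f : F f \in Lfun mu 2%:E.
Proof.
apply: integrable_square_Lfun2; first exact: schur_measurable.
by apply: (le_lt_trans (schur_square f)); rewrite ltry.
Qed.

Lemma integral_operatorE f :
  (integral_operator k f : T -> R) = F f %[ae mu].
Proof. exact/LclassK/schur_Lfun. Qed.

Lemma integral_operator_norm f : `|integral_operator k f| <= a * `|f|.
Proof.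
rewrite -ler_sqr ?nnegrE ?mulr_ge0 ?(ltW a0)// exprMn !normL2_sqr.
rewrite -lee_fin; apply: le_trans (schur_square f).
rewrite dotL2E le_eqVlt; apply/orP; left; apply/eqP.
apply: ae_eq_integral => //.
- by apply/measurable_EFinP; apply: measurable_funM; exact: L2_measurable.
- by apply/measurable_EFinP; apply: measurable_funX; exact: schur_measurable.
- by apply: filterS (integral_operatorE f) => x /= + _ => -> //; rewrite expr2.
Qed.

Lemma schur_ae_integrable f :
  {ae mu, forall x, mu.-integrable setT (fun y => (k x y * f y)%:E)}.
Proof. exact: (ae_integrable1 (schur_integrable_prod f)). Qed.

(** The integrals defining the images converge absolutely for almost every [x] only, which suffices
    for an equality of classes. *)
Lemma integral_operator_linear : linear (integral_operator (mu := mu) k).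
Proof.
move=> c f g; apply/Lspace_eqP.
have fg : (c *: f + g : T -> R) = (fun y => c * f y + g y) %[ae mu].
  apply: filterS2 (LspaceDE (c *: f) g) (LspaceZE c f) => y /= -> // -> //.
near=> x => _.
rewrite (near (LspaceDE (c *: integral_operator k f) (integral_operator k g)) x)//.
rewrite (near (LspaceZE c (integral_operator k f)) x)//.
rewrite !(near (integral_operatorE _) x)//.
rewrite -RintegralZl//; last exact: (near (schur_ae_integrable f) x).
rewrite -RintegralD//; last 2 first.
- have := near (schur_ae_integrable f) x.
  by move=> /(_ _) /(integrableZl measurableT c); apply.
- exact: (near (schur_ae_integrable g) x).
apply: eq_ae_Rintegral.
- by apply: measurable_funM; [exact: jointly_measurable1|exact: L2_measurable].
- by apply: measurable_funD; do ?apply: measurable_funM => //;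
    do ?[exact: jointly_measurable1|exact: L2_measurable].
- by apply: filterS fg => y /= -> //; rewrite mulrDr mulrCA.
Unshelve. all: by end_near. Qed.

End schur.

Lemma schur_boundD k1 k2 a1 a2 : schur_bound k1 a1 -> schur_bound k2 a2 ->
  schur_bound (fun x y => k1 x y + k2 x y) (a1 + a2).
Proof.
move=> [a10 mk1 k1x k1y] [a20 mk2 k2x k2y].
have addI (u v : T -> R) : measurable_fun setT u -> measurable_fun setT v ->
    (\int[mu]_y `|u y|%:E <= a1%:E)%E -> (\int[mu]_y `|v y|%:E <= a2%:E)%E ->
    (\int[mu]_y `|u y + v y|%:E <= (a1 + a2)%:E)%E.
  move=> mu' mv ua va; rewrite EFinD.
  apply: le_trans (leeD ua va).
  rewrite -ge0_integralD//; last 2 first.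
  - by apply/measurable_EFinP; exact: measurableT_comp.
  - by apply/measurable_EFinP; exact: measurableT_comp.
  apply: ge0_le_integral => //.
  - by apply/measurable_EFinP; apply: measurableT_comp => //; exact: measurable_funD.
  - by apply/measurable_EFinP; apply: measurable_funD; exact: measurableT_comp.
  - by move=> y _; rewrite lee_fin ler_normD.
split.
- exact: addr_gt0.
- exact: measurable_funD.
- move=> x; apply: addI => //; exact: jointly_measurable1.
- move=> y; apply: (addI (k1 ^~ y) (k2 ^~ y)) => //; exact: jointly_measurable2.
Qed.

Lemma integral_operatorD k1 k2 a1 a2 f : schur_bound k1 a1 -> schur_bound k2 a2 ->
  integral_operator (fun x y => k1 x y + k2 x y) f =
  integral_operator k1 f + integral_operator k2 f.
Proof.
move=> ka1 ka2; apply/Lspace_eqP; near=> x => _.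
rewrite (near (LspaceDE (integral_operator k1 f) (integral_operator k2 f)) x)//.
rewrite (near (integral_operatorE ka1 f) x)//.
rewrite (near (integral_operatorE ka2 f) x)//.
rewrite (near (integral_operatorE (schur_boundD ka1 ka2) f) x)//.
rewrite -RintegralD//; last 2 first.
- exact: (near (schur_ae_integrable ka1 f) x).
- exact: (near (schur_ae_integrable ka2 f) x).
by apply: eq_Rintegral => y _; rewrite mulrDl.
Unshelve. all: by end_near. Qed.

(** The summand 1 keeps the Schur bound positive when [mu] is zero. *)
Lemma bounded_schur k M : 0 < M -> jointly_measurable k ->
  (forall x y, `|k x y| <= M) ->
  schur_bound k (M * (fine (mu setT) + 1)).
Proof.
move=> M0 mk kM.
have intM (u : T -> R) : measurable_fun setT u -> (forall y, `|u y| <= M) ->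
    (\int[mu]_y `|u y|%:E <= (M * (fine (mu setT) + 1))%:E)%E.
  move=> mu' uM.
  apply: (@le_trans _ _ (\int[mu]_y (cst M%:E y))%E).
    apply: ge0_le_integral => //.
      by apply/measurable_EFinP; exact: measurableT_comp.
    by move=> y _; rewrite lee_fin.
  rewrite integral_cst//.
  apply: (@le_trans _ _ (M%:E * (fine (mu setT))%:E)%E).
    by rewrite fineK// fin_num_measure.
  by rewrite -EFinM lee_fin ler_wpM2l ?(ltW M0)// lerDl.
split => //.
- by rewrite mulr_gt0// ltr_wpDl// fine_ge0.
- by move=> x; apply: intM => //; exact: jointly_measurable1.
- by move=> y; apply: intM => //; exact: jointly_measurable2.
Qed.

End integral_operator.

(** * Hilbert-Schmidt bounds and step kernels *)

Section hilbert_schmidt.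
Context d (T : measurableType d) (R : realType).
Variable mu : {finite_measure set T -> \bar R}.
Local Notation H := (L2 mu).
Implicit Types (f g : H) (k : T -> T -> R).

Lemma integral_operator_sqr k a f : schur_bound mu k a ->
  (`|integral_operator k f| ^+ 2)%:E =
  (\int[mu]_x ((\int[mu]_y (k x y * f y)) ^+ 2)%:E)%E.
Proof.
move=> ka; rewrite normL2_sqr dotL2E; apply: ae_eq_integral => //.
- by apply/measurable_EFinP; apply: measurable_funM; exact: L2_measurable.
- by apply/measurable_EFinP; apply: measurable_funX; exact: schur_measurable ka f.
- by apply: filterS (integral_operatorE ka f) => x /= + _ => -> //; rewrite expr2.
Qed.

(** At a fixed [x] the images of the [u i] take as values the coefficients of the row [k x] along
    the [u i]. Bessel's inequality bounds the sum of their squares by the squared norm of the row;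
    then integrate in [x]. *)
Lemma hilbert_schmidt_sum k a (B : R) n (u : 'I_n -> H) :
  schur_bound mu k a ->
  (forall x, (\int[mu]_y (k x y ^+ 2)%:E <= B%:E)%E) ->
  orthonormal_family u ->
  \sum_i `|integral_operator k (u i)| ^+ 2 <= B * fine (mu setT).
Proof.
move=> ka kB ou; have [_ mk _ _] := ka.
rewrite -lee_fin -sumEFin.
under eq_bigr do rewrite (integral_operator_sqr _ ka).
rewrite -ge0_integral_sum//; last 2 first.
- move=> i; apply/measurable_EFinP; apply: measurable_funX.
  exact: schur_measurable ka (u i).
- by move=> i x _; rewrite lee_fin sqr_ge0.
apply: (@le_trans _ _ (\int[mu]_x (cst B%:E x))%E); last first.
  by rewrite integral_cst// EFinM fineK// fin_num_measure.
apply: ge0_le_integral => //.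
- by move=> x _; apply: sume_ge0 => i _; rewrite lee_fin sqr_ge0.
- apply: emeasurable_sum => i; apply/measurable_EFinP; apply: measurable_funX.
  exact: schur_measurable ka (u i).
move=> x _; have mkx := jointly_measurable1 mk x.
have Lk : k x \in Lfun mu 2%:E.
  apply: integrable_square_Lfun2 => //.
  by rewrite (le_lt_trans (kB x))// ltry.
pose G : H := Lclass (insubd 0 (k x)).
have GE : (G : T -> R) = k x %[ae mu] := LclassK Lk.
have dG i : \int[mu]_y (k x y * u i y) = dotL2 G (u i).
  apply: eq_ae_Rintegral.
  - by apply: measurable_funM => //; exact: L2_measurable.
  - by apply: measurable_funM; exact: L2_measurable.
  - by apply: filterS GE => y /= -> .
under eq_bigr do rewrite dG.
rewrite sumEFin; apply: le_trans (kB x).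
apply: (@le_trans _ _ (dotL2 G G)%:E).
  rewrite lee_fin; under eq_bigr do rewrite dotC.
  under eq_bigr do rewrite dotC.
  exact: bessel (orthonormal_partial ou) G.
rewrite dotL2E le_eqVlt; apply/orP; left; apply/eqP; apply: ae_eq_integral => //.
- by apply/measurable_EFinP; apply: measurable_funM; exact: L2_measurable.
- by apply/measurable_EFinP; exact: measurable_funX.
- by apply: filterS GE => y /= + _ => -> //; rewrite expr2.
Qed.

Lemma bounded_Lfun2 (v : T -> R) (M : R) : measurable_fun setT v ->
  (forall x, `|v x| <= M) -> v \in Lfun mu 2%:E.
Proof.
move=> mv vM; apply: integrable_square_Lfun2 => //.
apply: (@le_lt_trans _ _ (\int[mu]_x (cst (M ^+ 2)%:E x))%E).
  apply: ge0_le_integral => //.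
  - by move=> x _; rewrite lee_fin sqr_ge0.
  - by apply/measurable_EFinP; exact: measurable_funX.
  - move=> x _; rewrite lee_fin -real_normK ?num_real// ler_sqr ?nnegrE//.
    exact: le_trans (normr_ge0 _) (vM x).
rewrite integral_cst//= lte_mul_pinfty// ?lee_fin ?sqr_ge0// ltey_eq.
by rewrite fin_num_measure.
Qed.

Section step.
Variables (N : nat) (B : 'I_N -> set T) (g : 'I_N -> T -> R) (M : R).

(** For disjoint cells this is constant in [x] on each of them; the operator has rank at most [N],
    its image being spanned by the indicators of the cells. *)
Definition step_kernel x y : R := \sum_j \1_(B j) x * g j y.

Hypothesis mB : forall j, measurable (B j).
Hypothesis tB : trivIset setT B.
Hypothesis mg : forall j, measurable_fun setT (g j).
Hypothesis gM : forall j y, `|g j y| <= M.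

Let mI j : measurable_fun setT (\1_(B j) : T -> R).
Proof. by apply: measurable_indic; exact: mB. Qed.

Lemma step_kernel_schur : exists a, schur_bound mu step_kernel a.
Proof.
exists ((\sum_(j < N) `|M| + 1) * (fine (mu setT) + 1)); apply: bounded_schur.
- by rewrite ltr_wpDl// sumr_ge0.
- rewrite /jointly_measurable /step_kernel.
  apply: measurable_sum => j; apply: measurable_funM.
    by apply: (measurableT_comp _ measurable_fst); exact: mI.
  exact: (measurableT_comp _ measurable_snd).
move=> x y; rewrite (le_trans (ler_norm_sum _ _ _))//.
apply: (@le_trans _ _ (\sum_(j < N) `|M|)); last by rewrite lerDl.
apply: ler_sum => j _; rewrite normrM ger0_norm// -[leRHS]mul1r ler_pM//.
by rewrite (le_trans (gM j y))// ler_norm.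
Qed.

Lemma indic_Lfun2 j : (\1_(B j) : T -> R) \in Lfun mu 2%:E.
Proof.
apply: (@bounded_Lfun2 _ 1) => // x.
by rewrite indicE; case: (_ \in _); rewrite ?normr1 ?normr0.
Qed.

Let w j : H := Lclass (insubd 0 (\1_(B j) : T -> R)).
Let wE j : (w j : T -> R) = \1_(B j) %[ae mu].
Proof. exact: LclassK (indic_Lfun2 j). Qed.

Let dot_w i j : dotL2 (w i) (w j) = (i == j)%:R * fine (mu (B i)).
Proof.
rewrite /dotL2; transitivity (\int[mu]_x ((i == j)%:R * \1_(B i) x)).
  apply: eq_ae_Rintegral.
  - by apply: measurable_funM; exact: L2_measurable.
  - by apply: measurable_funM => //; exact: mI.
  - apply: filterS2 (wE i) (wE j) => x /= -> // -> // _.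
    rewrite !indicE; have [->|ij] := eqVneq i j; rewrite /=.
      by rewrite mul1r; case: (_ \in _); rewrite ?mulr1 ?mulr0.
    rewrite mul0r; case: (boolP (x \in B i)) => [xi|]; last by rewrite mul0r.
    case: (boolP (x \in B j)) => [xj|]; last by rewrite mulr0.
    have := tB (i := i) (j := j) I I; move/eqP: ij => ij _.
    exfalso; apply: ij; apply: tB => //; exists x; split; exact: set_mem.
rewrite RintegralZl//; last first.
  apply/Lfun1_integrable; apply: Lfun_subset12; last exact: indic_Lfun2.
  exact: fin_num_measure.
by rewrite /Rintegral integral_indic// setIT.
Qed.

(** For a null cell [m j] and its inverse are both 0, so [e j] is 0 and [b j] is false; since [w j]
    is also 0 there, [w j = m j *: e j] holds in all cases. *)
Let m j := Num.sqrt (fine (mu (B j))).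
Let e j : H := (m j)^-1 *: w j.
Let b j := fine (mu (B j)) != 0.

Let oe : partial_orthonormal e b.
Proof.
move=> i j; rewrite dotZl dotZr dot_w; case: eqVneq => [<-|_]; last first.
  by rewrite mul0r !mulr0.
rewrite mul1r /b; have [->|z] := eqVneq (fine (mu (B i))) 0; first by rewrite !mulr0.
have p : 0 < fine (mu (B i)) by rewrite lt_def z fine_ge0.
rewrite mulrA -invfM -expr2 sqr_sqrtr ?(ltW p)// mulVf//.
Qed.

Let we j : w j = m j *: e j.
Proof.
rewrite scalerA; have [m0|m0] := eqVneq (m j) 0; last by rewrite divff// scale1r.
have -> : w j = 0; last by rewrite scaler0.
apply/eqP; rewrite -normr_eq0 -sqrf_eq0 normL2_sqr dot_w eqxx mul1r.
have : m j == 0 by apply/eqP.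
by rewrite sqrtr_eq0 le_eqVlt ltNge fine_ge0// orbF.
Qed.

Lemma Lspace_sumE (I : Type) (r : seq I) (F : I -> H) :
  ((\sum_(i <- r) F i : H) : T -> R) = (fun x => \sum_(i <- r) F i x) %[ae mu].
Proof.
elim: r => [|i r ih].
  rewrite big_nil; apply: filterS (Lspace0E mu (lee1n 2)) => x /= -> //.
  by rewrite big_nil.
rewrite big_cons; apply: filterS2 (LspaceDE (F i) (\sum_(i <- r) F i)) ih.
by move=> x /= -> // -> //; rewrite big_cons.
Qed.

(** Integrability of the partial sum is part of the conclusion so that the induction can use
    additivity. *)
Lemma Rintegral_sum (I : Type) (r : seq I) (F : I -> T -> R) :
  (forall i, mu.-integrable setT (EFin \o F i)) ->
  mu.-integrable setT (EFin \o (fun x => \sum_(i <- r) F i x)) /\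
  \int[mu]_x (\sum_(i <- r) F i x) = \sum_(i <- r) \int[mu]_x F i x.
Proof.
move=> iF; elim: r => [|i r [ih1 ih2]].
  have -> : (fun x => \sum_(i <- [::]) F i x) = cst 0.
    by apply/funext => x; rewrite big_nil.
  rewrite big_nil Rintegral_cst// mul0r; split => //.
  exact: (finite_measure_integrable_cst mu 0).
have -> : (fun x => \sum_(j <- i :: r) F j x) =
    (fun x => F i x + \sum_(j <- r) F j x).
  by apply/funext => x; rewrite big_cons.
rewrite big_cons RintegralD// ih2; split => //.
exact: (integrableD measurableT (iF i) ih1).
Qed.

Lemma step_operatorE f :
  integral_operator step_kernel f = \sum_j (\int[mu]_y (g j y * f y)) *: w j.
Proof.
have [a sa] := step_kernel_schur.
have ig j : mu.-integrable setT (EFin \o (fun y => g j y * f y)).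
  have Lg : g j \in Lfun mu 2%:E := bounded_Lfun2 (mg j) (gM j).
  by apply/Lfun1_integrable; apply: Lfun2_mul_Lfun1 => //; exact: L2_Lfun.
apply/Lspace_eqP.
have wall : {ae mu, forall x, forall j : 'I_N, (w j : T -> R) x = \1_(B j) x}.
  by apply: filter_forall => j; apply: filterS (wE j) => x /= ->.
have zall : {ae mu, forall x, forall j : 'I_N,
    ((\int[mu]_y (g j y * f y)) *: w j : H) x = (\int[mu]_y (g j y * f y)) * w j x}.
  apply: filter_forall => j.
  by apply: filterS (LspaceZE (\int[mu]_y (g j y * f y)) (w j)) => x /= ->.
near=> x => _.
rewrite (near (integral_operatorE sa f) x)//.
rewrite (near (Lspace_sumE _ (fun j => (\int[mu]_y (g j y * f y)) *: w j)) x)//.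
have W := near wall x; have Z := near zall x.
under [RHS]eq_bigr do rewrite Z// W//.
have ig' j : mu.-integrable setT (EFin \o (fun y => \1_(B j) x * (g j y * f y))).
  exact: (integrableZl measurableT (\1_(B j) x) (ig j)).
have [_ E] := Rintegral_sum (index_enum 'I_N) ig'.
transitivity (\int[mu]_y (\sum_j (\1_(B j) x * (g j y * f y)))).
  apply: eq_Rintegral => y _; rewrite /step_kernel mulr_suml.
  by apply: eq_bigr => j _; rewrite mulrA.
rewrite E; apply: eq_bigr => j _; rewrite mulrC -RintegralZl//.
Unshelve. all: by end_near. Qed.

(** The step part maps into the span of [e], so the distances in [singular_value_sum_dist] are at
    most the norms of the images under [k1 + k2]. The part [k1] is estimated vector by vector
    through its Schur bound, the part [k2] in total by [hilbert_schmidt_sum]; the factor 2 comes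
    from [(x + y)^2 <= 2 (x^2 + y^2)]. *)
Lemma singular_value_step k1 k2 a1 a2 (C : R) n t (u : 'I_n.+1 -> H) k :
  schur_bound mu k1 a1 -> schur_bound mu k2 a2 ->
  (forall x, (\int[mu]_y (k2 x y ^+ 2)%:E <= C%:E)%E) ->
  k = (fun x y => step_kernel x y + (k1 x y + k2 x y)) ->
  0 < t -> orthonormal_family u ->
  (forall i, exists2 s : R, t <= s &
    adjoint (integral_operator k) (integral_operator k (u i)) = s ^+ 2 *: u i) ->
  t ^+ 2 * (n.+1%:R - N%:R) <= 2 * (n.+1%:R * a1 ^+ 2 + C * fine (mu setT)).
Proof.
move=> s1 s2 kC kE t0 ou ku; have [a sa] := step_kernel_schur.
have s12 := schur_boundD s1 s2.
pose c i j := (\int[mu]_y (g j y * u i y)) * m j.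
apply: le_trans (singular_value_sum_dist c t0 ou ku oe) _.
apply: (@le_trans _ _ (\sum_i (2 * (`|integral_operator k1 (u i)| ^+ 2 +
    `|integral_operator k2 (u i)| ^+ 2)))).
  apply: ler_sum => i _.
  have -> : integral_operator k (u i) - \sum_j c i j *: e j =
      integral_operator k1 (u i) + integral_operator k2 (u i).
    rewrite kE (integral_operatorD _ sa s12) (integral_operatorD _ s1 s2).
    rewrite step_operatorE addrAC; under eq_bigr do rewrite we scalerA.
    by rewrite subrr add0r.
  set x := integral_operator k1 _; set y := integral_operator k2 _.
  apply: (@le_trans _ _ ((`|x| + `|y|) ^+ 2)).
    by rewrite ler_sqr ?nnegrE// ?addr_ge0// ler_normD.
  rewrite -subr_ge0 (_ : _ - _ = (`|x| - `|y|) ^+ 2) ?sqr_ge0//; ring.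
rewrite -mulr_sumr ler_wpM2l// big_split/= lerD//; last first.
  exact: hilbert_schmidt_sum s2 kC ou.
have -> : n.+1%:R * a1 ^+ 2 = \sum_(i < n.+1) a1 ^+ 2.
  by rewrite sumr_const card_ord mulr_natl.
apply: ler_sum => i _.
have /eqP : `|u i| ^+ 2 = 1 by rewrite normL2_sqr ou eqxx.
rewrite sqrp_eq1// => /eqP ui; have := integral_operator_norm s1 (u i).
rewrite ui mulr1 => ka; rewrite ler_sqr ?nnegrE//.
exact: le_trans (normr_ge0 _) ka.
Qed.
End step.

End hilbert_schmidt.

(** * Completeness of L2 and compactness *)

Section geometric.
Variable R : realType.

Lemma eseries_geometric (c q : R) : 0 <= q -> q < 1 ->
  (\sum_(n <oo) (c * q ^+ n)%:E = (c / (1 - q))%:E)%E.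
Proof.
move=> q0 q1; apply/cvg_lim => //; apply: cvg_EFin.
  by apply: nearW => n; rewrite sumEFin.
rewrite (_ : _ \o _ = series (geometric c q)); last first.
  by apply/funext => n /=; rewrite sumEFin.
by apply: cvg_geometric_series; rewrite ger0_norm.
Qed.

End geometric.

Section completeness.
Context d (T : measurableType d) (R : realType).
Variable mu : {finite_measure set T -> \bar R}.
Local Notation H := (L2 mu).

(** Cauchy-Schwarz against the constant function 1. *)
Lemma L2_integral_norm (f : H) :
  (\int[mu]_x `|f x|%:E <= (`|f| * Num.sqrt (fine (mu setT)))%:E)%E.
Proof.
have mf := @L2_measurable _ _ _ mu f.
have := cauchy_schwarz_integral mu mf (@measurable_cst _ _ T R setT 1).
under eq_integral do rewrite mulr1.
under [X in (_ * X)%E]eq_integral do rewrite expr1n.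
rewrite (integral_cst mu measurableT 1%E) mul1e.
under [X in (_ <= X * _)%E]eq_integral do rewrite expr2.
rewrite -dotL2E -normL2_sqr => H1.
have I0 : (0 <= \int[mu]_x `|f x|%:E)%E by exact: integral_ge0.
have muE : ((`|f| ^+ 2)%:E * mu setT = (`|f| ^+ 2 * fine (mu setT))%:E)%E.
  by rewrite [RHS]EFinM [in RHS]fineK// fin_num_measure.
move: H1 I0; rewrite muE; case: (\int[mu]_x _)%E => [r| |//].
  rewrite poweR_EFin !lee_fin => + r0; rewrite powR_mulrn// => rf.
  rewrite -ler_sqr ?nnegrE ?mulr_ge0 ?sqrtr_ge0// exprMn sqr_sqrtr//.
  exact: fine_ge0.
by rewrite poweRyr// leye_eq.
Qed.

(** The L1 norms of the increments are dominated by a geometric series, so the series of their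
    absolute values has a finite integral and is finite almost everywhere. There the telescoping
    series converges absolutely. *)
Lemma L2_cauchy_ae_cvg (u : nat -> H) :
  (forall n, `|u n.+1 - u n| <= 2^-1 ^+ n) ->
  {ae mu, forall x, cvgn (fun n => u n x)}.
Proof.
move=> uc.
have mD n : measurable_fun setT (fun x => (u n.+1 - u n : H) x : R).
  exact: L2_measurable.
have mabs n : measurable_fun setT (fun x => (`|(u n.+1 - u n : H) x|)%:E).
  by apply/measurable_EFinP; exact: measurableT_comp.
pose c := Num.sqrt (fine (mu setT)).
have fin : (\int[mu]_x (\sum_(n <oo) `|(u n.+1 - u n : H) x|%:E) < +oo)%E.
  rewrite integral_nneseries//.
  apply: (@le_lt_trans _ _ (\sum_(n <oo) (c * 2^-1 ^+ n)%:E)%E).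
    apply: lee_nneseries => [n _ _|n _]; first exact: integral_ge0.
    rewrite (le_trans (L2_integral_norm _))// lee_fin mulrC ler_wpM2l// ?sqrtr_ge0//.
  by rewrite eseries_geometric ?ltry//; lra.
have aefin : {ae mu, forall x, (\sum_(n <oo) `|(u n.+1 - u n : H) x|%:E < +oo)%E}.
  have : mu.-integrable setT (fun x => \sum_(n <oo) `|(u n.+1 - u n : H) x|%:E)%E.
    apply/integrableP; split.
      apply: ge0_emeasurable_sum => // n x _ _; by rewrite lee_fin.
    under eq_integral do rewrite gee0_abs ?nneseries_ge0//.
    exact: fin.
  move=> /(integrable_ae measurableT); apply: filterS => x /(_ I).
  by rewrite fin_numElt => /andP[].
have aeB : {ae mu, forall x, forall n, (u n.+1 - u n : H) x = u n.+1 x - u n x :> R}.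
  apply/ae_foralln => n.
  by apply: filterS2 (LspaceDE (u n.+1) (- u n)) (LspaceNE (u n)) => x -> // -> .
apply: filterS2 aefin aeB => x xfin xB.
have cS : cvgn (series (fun n => u n.+1 x - u n x : R)).
  apply: (@normed_cvg R R^o); apply: nondecreasing_is_cvgn.
    by apply: nondecreasing_series => n _ _ /=.
  have S0 : (0 <= \sum_(n <oo) `|(u n.+1 - u n : H) x|%:E)%E by exact: nneseries_ge0.
  exists (fine (\sum_(n <oo) `|(u n.+1 - u n : H) x|%:E)%E) => _ [n _ <-].
  rewrite -lee_fin fineK ?ge0_fin_numE//.
  have -> : (([normed series (fun n => u n.+1 x - u n x : R)] n)%:E =
      \sum_(0 <= i < n) `|(u i.+1 - u i : H) x|%:E)%E.
    by rewrite /series/= -sumEFin; apply: eq_bigr => i _; rewrite xB.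
  exact: nneseries_lim_ge.
have -> : (fun n => u n x) = (fun n => u 0 x + series (fun n => u n.+1 x - u n x : R) n).
  apply/funext; elim => [|n ih]; first by rewrite /series/= big_geq// addr0.
  by rewrite /series/= big_nat_recr//= addrA -ih addrC subrK.
exact: is_cvgD (is_cvg_cst _) cS.
Qed.

(** Riesz-Fischer: take the almost everywhere limit and apply Fatou's lemma to the squares of
    [u (n + m) - u n] as [m] tends to infinity. *)
Lemma L2_complete (u : nat -> H) :
  (forall n, `|u n.+1 - u n| <= 2^-1 ^+ n) ->
  exists l : H, forall n, `|l - u n| <= 2 * 2^-1 ^+ n.
Proof.
move=> uc.
have umn n m : `|u (n + m)%N - u n| <= 2 * 2^-1 ^+ n.
  suff : `|u (n + m)%N - u n| <= 2 * (2^-1 ^+ n - 2^-1 ^+ (n + m)).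
    move=> /le_trans; apply; rewrite ler_wpM2l// gerBl.
    by rewrite exprn_ge0.
  elim: m => [|m ih]; first by rewrite addn0 !subrr normr0 mulr0.
  rewrite addnS -(subrK (u (n + m)%N) (u (n + m).+1)) -addrA.
  rewrite (le_trans (ler_normD _ _))//.
  apply: (le_trans (lerD (uc _) ih)).
  by rewrite exprS; lra.
(* The upper limit is measurable everywhere and equals the limit wherever the sequence converges. *)
pose l x := fine (limn_esup (fun n => (u n x)%:E)).
have ml : measurable_fun setT l.
  apply: (measurableT_comp (fine_measurable measurableT)).
  apply: measurable_fun_limn_esup => n; apply/measurable_EFinP.
  exact: L2_measurable.
have mlu n : measurable_fun setT (fun x => l x - u n x : R).
  by apply: measurable_funB => //; exact: L2_measurable.
have ul : {ae mu, forall x, u n x @[n --> \oo] --> l x}.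
  apply: filterS (L2_cauchy_ae_cvg uc) => x /cvg_ex[/= r ur].
  suff -> : l x = r by [].
  rewrite /l; suff -> : limn_esup (fun n => (u n x)%:E) = r%:E by [].
  have /cvg_limn_einf_sup[_ ->]// : (u n x)%:E @[n --> \oo] --> r%:E.
  by apply: cvg_EFin => //; exact: nearW.
have lun n : (\int[mu]_x ((l x - u n x) ^+ 2)%:E <= ((2 * 2^-1 ^+ n) ^+ 2)%:E)%E.
  pose f m x := (((u (n + m)%N - u n : H) x : R) ^+ 2)%:E.
  have mf m : measurable_fun setT (f m).
    apply/measurable_EFinP; apply: measurable_funX; exact: L2_measurable.
  apply: (@le_trans _ _ (\int[mu]_x limn_einf (f ^~ x))%E).
    rewrite le_eqVlt; apply/orP; left; apply/eqP; apply: ae_eq_integral => //.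
    - by apply/measurable_EFinP; exact: measurable_funX.
    - rewrite /limn_einf.
      apply: measurableT_comp => //.
      by apply: measurable_fun_limn_esup => m; exact: measurableT_comp.
    - have BE : {ae mu, forall x, forall m,
          (u (n + m)%N - u n : H) x = u (n + m)%N x - u n x :> R}.
        apply/ae_foralln => m.
        by apply: filterS2 (LspaceDE (u (n + m)%N) (- u n)) (LspaceNE (u n)) => x -> // -> .
      apply: filterS2 ul BE => x ulx BEx _.
      have /cvg_limn_einf_sup[-> _]// : f m x @[m --> \oo] --> ((l x - u n x) ^+ 2)%:E.
      apply: cvg_EFin; first exact: nearW.
      rewrite (_ : _ \o _ = (fun m => (u (n + m)%N x - u n x) * (u (n + m)%N x - u n x))).
        have cB : (u (n + m)%N x - u n x) @[m --> \oo] --> l x - u n x.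
          apply: cvgB; last exact: cvg_cst.
          have := ulx; rewrite -(cvg_shiftn n).
          by under eq_fun do rewrite addnC.
        by rewrite expr2; apply: cvgM.
      by apply/funext => m; rewrite /= /f BEx expr2.
  have f0 m x : setT x -> (0 <= f m x)%E by rewrite lee_fin sqr_ge0.
  apply: (le_trans (fatou mu measurableT mf f0)).
  have intf m : (\int[mu]_x f m x <= ((2 * 2^-1 ^+ n) ^+ 2)%:E)%E.
    under eq_integral do rewrite /f expr2.
    rewrite -dotL2E -normL2_sqr lee_fin ler_sqr ?nnegrE ?mulr_ge0 ?exprn_ge0//.
  rewrite limn_einf_lim; apply: lime_le; first exact: is_cvg_einfs.
  apply: nearW => m; apply: le_trans (intf m).
  by apply: ereal_inf_lbound; exists m => //=.
(* The square integrability known so far is that of [l - u 0], so the limit is built as the class of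
   this difference plus [u 0]. *)
have LD : (fun x => l x - u 0 x : R) \in Lfun mu 2%:E.
  by apply: integrable_square_Lfun2 => //; rewrite (le_lt_trans (lun 0))// ltry.
pose D : H := Lclass (insubd 0 (fun x => l x - u 0 x)).
have DE : (D : T -> R) = (fun x => l x - u 0 x) %[ae mu] := LclassK LD.
exists (D + u 0) => n.
have LE : (D + u 0 - u n : T -> R) = (fun x => l x - u n x) %[ae mu].
  near=> x => _.
  rewrite (near (LspaceDE (D + u 0) (- u n)) x)// (near (LspaceNE (u n)) x)//.
  by rewrite (near (LspaceDE D (u 0)) x)// (near DE x)// subrK.
rewrite -ler_sqr ?nnegrE ?mulr_ge0 ?exprn_ge0//.
rewrite normL2_sqr -lee_fin; apply: le_trans (lun n).
rewrite dotL2E le_eqVlt; apply/orP; left; apply/eqP.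
apply: ae_eq_integral => //.
- by apply/measurable_EFinP; apply: measurable_funM; exact: L2_measurable.
- by apply/measurable_EFinP; exact: measurable_funX.
- by apply: filterS LE => x /= + _ => -> //; rewrite expr2.
Unshelve. all: by end_near. Qed.

End completeness.

Section compactness.
Context d (T : measurableType d) (R : realType).
Variable mu : {finite_measure set T -> \bar R}.
Local Notation H := (L2 mu).

Lemma span_compact N (w : 'I_N -> H) (M : R) :
  compact [set \sum_j v ord0 j *: w j | v in
            [set v : 'rV[R]_N | forall j, `[- M, M]%classic (v ord0 j)]].
Proof.
apply: continuous_compact; last first.
  by apply: (rV_compact (A := fun=> `[- M, M]%classic)) => j; exact: segment_compact.
apply: continuous_subspaceT => v.
have add_cont : continuous (fun z : H * H => z.1 + z.2) by exact: add_continuous.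
have := @cvg_big _ _ _ 0 xpredT add_cont _ (nbhs v) (index_enum 'I_N)
  (fun j (v : 'rV[R]_N) => v ord0 j *: w j) (fun j => v ord0 j *: w j) (nbhs_filter v).
apply => j _; apply: cvgZr_tmp; exact: coord_continuous.
Qed.

(** Total boundedness and completeness give compactness. An ultrafilter containing the closure
    contains arbitrarily small balls; their centres form a Cauchy sequence, and the ultrafilter
    converges to its limit. *)
Lemma near_compact_closure (S : set H) :
  (forall e : R, 0 < e -> exists2 C : set H, compact C &
    forall f, S f -> exists2 g, C g & `|f - g| <= e) ->
  compact (closure S).
Proof.
move=> SC; rewrite compact_ultra => F UF FS.
have FF : ProperFilter F by exact: ultra_proper.
have small (e : R) : 0 < e -> exists g : H, F (ball g e).
  move=> e0; have e40 : 0 < e / 4 by rewrite divr_gt0.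
  (* Three errors of [e / 4] add up: from a point of the closure to [S], from [S] to [C], and from
     [C] to a centre of the finite cover. *)
  have [C] := SC _ e40; rewrite compact_cover => cC SCe.
  have [||D DC Cov] := cC _ C (fun g : H => ball g (e / 4)).
  - by move=> g _; exact: ball_open.
  - by move=> g Cg; exists g => //; exact: ballxx.
  apply: contrapT => nex.
  have FD : F (\bigcap_(g in [set` D]) ~` ball g e).
    apply: filter_bigI => g gD; case: (in_ultra_setVsetC (ball g e) UF) => // Fg.
    by exfalso; apply: nex; exists g.
  have [f [Sf fD]] := filter_ex (filterI FS FD).
  have [f' [Sf' ff']] := Sf _ (nbhsx_ballx f _ e40).
  have [g Cg f'g] := SCe _ Sf'.
  have [h hD gh] := Cov _ Cg.
  apply: (fD h hD); move: ff' gh; rewrite -!ball_normE /ball_/= => ff' gh.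
  rewrite (_ : h - f = (h - g) + (g - f') + (f' - f)); last first.
    by rewrite !addrA subrK subrK.
  rewrite (le_lt_trans (ler_normD _ _))//.
  rewrite (le_lt_trans (lerD (ler_normD _ _) (lexx _)))//.
  move: ff' f'g; rewrite (distrC f f') (distrC f' g) => *; lra.
(* Two members of the filter meet, so with these radii consecutive centres are within [2^-n], as
   [L2_complete] demands. *)
have [a aP] : exists a : nat -> H, forall n, F (ball (a n) (2^-1 ^+ n / 2)).
  have /choice[a aP] : forall n, exists g : H, F (ball g (2^-1 ^+ n / 2)).
    by move=> n; apply: small; rewrite divr_gt0// exprn_gt0.
  by exists a.
have [|l lP] := @L2_complete _ _ _ mu a.
  move=> n; have [f []] := filter_ex (filterI (aP n) (aP n.+1)).
  rewrite -!ball_normE /ball_/= => nf Snf.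
  rewrite -(subrK f (a n.+1)) -addrA (le_trans (ler_normD _ _))//.
  move: nf Snf; rewrite (distrC (a n)) exprS => *.
  have : (0 : R) < 2^-1 ^+ n by rewrite exprn_gt0.
  by lra.
have Fl : F --> l.
  apply/cvg_ballP => e e0.
  (* The distance from [l] to [a n] is at most [2 * 2^-n] and the ball adds [2^-n / 2], in total
     less than [3 * 2^-n]. *)
  have [n ne] : exists n, 2^-1 ^+ n < e / 3 :> R.
    have : geometric 1 (2^-1 : R) n @[n --> \oo] --> (0 : R).
      by apply: cvg_geometric; rewrite ger0_norm//; lra.
    move=> /cvgrPdist_lt /(_ (e / 3)) []; first by rewrite divr_gt0.
    move=> n _ /(_ n (leqnn n)).
    by rewrite /geometric/= sub0r normrN mul1r ger0_norm ?exprn_ge0//; exists n.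
  apply: filterS (aP n); move=> f; rewrite -!ball_normE /ball_/= => nf.
  rewrite -(subrK (a n) l) -addrA (le_lt_trans (ler_normD _ _))//.
  have := lP n; have : (0 : R) < 2^-1 ^+ n by rewrite exprn_gt0.
  move=> *; lra.
exists l; split => //.
by apply: closed_closure => B /Fl FB; exact: filter_ex (filterI FS FB).
Qed.

(** A step operator sends the unit ball into a compact set of combinations of finitely many
    indicators, and by Schur's test it is within [e] of the operator on that ball. *)
Lemma integral_operator_compact k a : schur_bound mu k a ->
  (forall e : R, 0 < e -> exists N (B : 'I_N -> set T) (g : 'I_N -> T -> R) (M : R),
    [/\ forall j, measurable (B j), trivIset setT B,
        forall j, measurable_fun setT (g j), forall j y, `|g j y| <= M &
        schur_bound mu (fun x y => k x y - step_kernel B g x y) e]) ->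
  compact_operator (integral_operator (mu := mu) k).
Proof.
move=> ka kstep; split; first exact: integral_operator_linear ka.
apply: near_compact_closure => e e0.
have [N [B [g [M [mB tB mg gM ke]]]]] := kstep _ e0.
have [a' sa] := step_kernel_schur mu mB mg gM.
pose G j : H := Lclass (insubd 0 (g j)).
have GE j : (G j : T -> R) = g j %[ae mu] := LclassK (bounded_Lfun2 mu (mg j) (gM j)).
pose w j : H := Lclass (insubd 0 (\1_(B j) : T -> R)).
(* By Cauchy-Schwarz the [j]-th coefficient is at most the norm of [G j]; the sum of these norms
   bounds all coefficients at once. *)
exists [set \sum_j v ord0 j *: w j | v in
  [set v : 'rV[R]_N | forall j, `[- \sum_j `|G j|, \sum_j `|G j|]%classic (v ord0 j)]].
  exact: span_compact.
move=> _ [f f1 <-].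
exists (integral_operator (step_kernel B g) f).
  exists (\row_j \int[mu]_y (g j y * f y)) => [j /=|]; last first.
    rewrite (step_operatorE mB mg gM).
    by apply: eq_bigr => j _; rewrite mxE.
  rewrite in_itv/= mxE -ler_norml.
  have -> : \int[mu]_y (g j y * f y) = dotL2 (G j) f.
    apply: eq_ae_Rintegral.
    - by apply: measurable_funM => //; exact: L2_measurable.
    - by apply: measurable_funM; exact: L2_measurable.
    - by apply: filterS (GE j) => y /= ->.
  rewrite (le_trans (dot_le_normM _ _))//.
  apply: (@le_trans _ _ `|G j|); first by rewrite ler_piMr.
  by rewrite (bigD1 j)//= lerDl sumr_ge0.
have kE : k = (fun x y => (k x y - step_kernel B g x y) + step_kernel B g x y).
  by apply/funext => x; apply/funext => y; rewrite subrK.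
rewrite {1}kE (integral_operatorD _ ke sa) addrK.
apply: (le_trans (integral_operator_norm ke f)).
by rewrite ler_piMr// ltW.
Qed.

End compactness.

(** * Decay of singular values and Schatten norms *)

Section power_series.
Variable R : realType.

Lemma powR2_lt1 (s : R) : s < 0 -> 2 `^ s < 1 :> R.
Proof.
move=> s0; rewrite -(opprK s) powRN invf_lt1 ?powR_gt0//.
have /gt0_ltr_powR ms : 0 < - s by rewrite oppr_gt0.
by have := ms 1 2; rewrite powR1; apply; rewrite ?nnegrE ?ler0n// ltr1n.
Qed.

(** Cauchy condensation: the block from [2 ^ J] to [2 ^ J.+1] has [2 ^ J] terms, none larger than
    its first one. *)
Lemma sum_powRN_dyadic (q : R) J : 1 < q ->
  \sum_(1 <= m < 2 ^ J) m%:R `^ (- q) <= \sum_(0 <= j < J) (2 `^ (1 - q)) ^+ j :> R.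
Proof.
move=> q1; elim: J => [|J ih]; first by rewrite expn0 !big_geq.
rewrite (@big_cat_nat _ _ _ (2 ^ J)%N)//= ?expn_gt0// ?leq_exp2l//.
rewrite [leRHS]big_nat_recr//= lerD//.
apply: (@le_trans _ _ (\sum_(2 ^ J <= m < 2 ^ J.+1) (2 ^ J)%:R `^ (- q))).
  rewrite !big_seq ler_sum// => m; rewrite mem_index_iota => /andP[Jm _].
  rewrite !powRN lef_pV2 ?posrE ?powR_gt0 ?ltr0n ?expn_gt0//; last first.
    by rewrite (leq_trans _ Jm)// expn_gt0.
  by rewrite ge0_ler_powR ?nnegrE ?ler_nat// ltW// (lt_trans _ q1).
rewrite sumr_const_nat expnS mul2n -addnn addnK.
rewrite -[leLHS]mulr_natl natrX -!powR_mulrn ?powR_ge0// -!powRrM.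
rewrite -powRD ?pnatr_eq0 ?implybT//.
by rewrite le_eqVlt; apply/orP; left; apply/eqP; congr (_ `^ _); ring.
Qed.

Lemma eseries_powRN (q : R) : 1 < q ->
  (\sum_(n <oo) (n.+1%:R `^ (- q))%:E <= ((1 - 2 `^ (1 - q))^-1)%:E)%E.
Proof.
move=> q1.
have z0 : 0 <= 2 `^ (1 - q) :> R by exact: powR_ge0.
have z1 : 2 `^ (1 - q) < 1 :> R by rewrite powR2_lt1// subr_lt0.
apply: lime_le; first by apply: is_cvg_nneseries => n _ _; rewrite lee_fin powR_ge0.
apply: nearW => n; rewrite sumEFin lee_fin.
apply: (@le_trans _ _ (\sum_(1 <= m < 2 ^ n) m%:R `^ (- q))).
  (* Upper ends are exclusive: the first [n] terms have indices 1 to [n], all below [2 ^ n]. *)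
  have : (n.+1 <= 2 ^ n)%N by rewrite ltn_expl.
  move: (2 ^ n)%N => [//|N]; rewrite ltnS => nN.
  rewrite [leRHS]big_add1/= [leRHS](@big_cat_nat _ _ _ n)//= lerDl.
  by rewrite sumr_ge0// => m _; rewrite powR_ge0.
apply: (le_trans (sum_powRN_dyadic _ q1)).
have := eseries_geometric 1 z0 z1; rewrite mul1r -lee_fin => <-.
rewrite -sumEFin; under [leLHS]eq_bigr do rewrite -[X in X%:E]mul1r.
by apply: nneseries_lim_ge => m _ _; rewrite lee_fin mul1r exprn_ge0.
Qed.

End power_series.

Section schatten_decay.
Context d (T : measurableType d) (R : realType).
Variable mu : {finite_measure set T -> \bar R}.
Local Notation H := (L2 mu).

(** Comparison with the convergent series of [(n + 1)^(- th p)]. Apart from the factor [M], the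
    constant depends on [th] and [p] only, which makes the final bound linear in the Hölder
    constant. *)
Lemma schatten_norm_decay (A : H -> H) (p th M : R) : 1 <= p -> 1 < th * p -> 0 <= M ->
  (forall n, 0 <= singular_value A n <= M * n.+1%:R `^ (- th)) ->
  (schatten_norm p A <= (((1 - 2 `^ (1 - th * p))^-1) `^ p^-1 * M)%:E)%E.
Proof.
move=> p1 thp M0 sA; have p0 : 0 < p by rewrite (lt_le_trans ltr01).
have z1 : 2 `^ (1 - th * p) < 1 :> R by rewrite powR2_lt1// subr_lt0.
rewrite /schatten_norm Lnorm_counting//.
set S := (1 - _)^-1.
have S0 : 0 <= S by rewrite invr_ge0 subr_ge0 ltW.
have -> : (S `^ p^-1 * M)%:E = ((S * M `^ p)%:E `^ p^-1)%E.
  rewrite poweR_EFin powRM ?powR_ge0//.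
  by rewrite -powRrM divff ?gt_eqF// powRr1.
have sum0 : (0 <= \sum_(k <oo) (`|(EFin \o singular_value A) k| `^ p))%E.
  by apply: nneseries_ge0 => k _ _; exact: poweR_ge0.
apply: gt0_ler_poweR; rewrite ?invr_ge0 ?(ltW p0)// ?in_itv/= ?leey ?andbT//.
  by rewrite lee_fin mulr_ge0// powR_ge0.
apply: (@le_trans _ _ (\sum_(k <oo) ((M `^ p)%:E * (k.+1%:R `^ (- (th * p)))%:E))%E).
  apply: lee_nneseries => [k _ _|k _]; first by rewrite lee_fin powR_ge0.
  have /andP[s0 sM] := sA k.
  rewrite /= ger0_norm// lee_fin.
  apply: (@le_trans _ _ ((M * k.+1%:R `^ (- th)) `^ p)).
    by rewrite ge0_ler_powR ?nnegrE ?(ltW p0)// mulr_ge0// powR_ge0.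
  by rewrite powRM ?powR_ge0// -powRrM mulNr.
rewrite nneseriesZl => [|k _]; last by rewrite lee_fin powR_ge0.
by rewrite [S * _]mulrC EFinM lee_wpmul2l ?lee_fin ?powR_ge0//; exact: eseries_powRN.
Qed.

End schatten_decay.

(** * Ahlfors regular spaces *)

Section geometry.
Context (R : realType) (X : pointedMetricType R).
Implicit Types x y z : X.

Hypothesis X_compact : compact [set: X].

(** A real supremum is meaningful only for a bounded set; compactness provides the bound through a
    finite cover by balls around one point. *)
Lemma mdist_le_diam x y : mdist x y <= diam X.
Proof.
have [x0 _] : exists x : X, True by exists x.
pose U n := [set y : X | mdist x0 y < n%:R].
have oU n : open (U n).
  rewrite openE => z /= zn; rewrite /interior; apply/nbhs_ballP.
  exists (n%:R - mdist x0 z) => /=; first by rewrite subr_gt0.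
  move=> w; rewrite ballEmdist/= => zw.
  by rewrite /U/= (le_lt_trans (metric_triangle _ z _))// -ltrBrDl.
move: X_compact; rewrite compact_cover => /(_ _ [set: nat] U) [].
- by move=> n _; exact: oU.
- move=> z _; exists (Num.bound (mdist x0 z)) => //.
  by rewrite /U/= archi_boundP// mdist_ge0.
move=> D _ cov.
pose N := (\max_(n <- enum_fset D) n)%N.
have bN z : mdist x0 z <= N%:R.
  have [n nD zn] := cov z I; rewrite (le_trans (ltW zn))// ler_nat.
  exact: (@leq_bigmax_seq _ (enum_fset D) xpredT id).
apply: ub_le_sup; last by exists x => //; exists y.
exists (N%:R + N%:R) => _ [z _ [w _ <-]].
rewrite (le_trans (metric_triangle _ x0 _))// lerD ?bN//.
by rewrite metric_sym bN.
Qed.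

Lemma diam_ge0 : 0 <= diam X.
Proof. by rewrite (le_trans _ (mdist_le_diam point point))// mdist_ge0. Qed.

Lemma open_borel_measurable (A : set X) : open A -> measurable (A : set (borelType X)).
Proof. by move=> oA; exact: sub_sigma_algebra. Qed.

Lemma mclosed_ball_measurable x r :
  measurable (mclosed_ball x r : set (borelType X)).
Proof.
rewrite -[mclosed_ball x r]setCK; apply: measurableC; apply: open_borel_measurable.
rewrite openE => y /=; rewrite /mclosed_ball/= => /negP; rewrite -ltNge => ry.
apply/nbhs_ballP; exists (mdist x y - r) => /=; first by rewrite subr_gt0.
move=> z; rewrite ballEmdist/= => yz; apply/negP; rewrite -ltNge.
have := metric_triangle x z y; rewrite (metric_sym z y); lra.
Qed.

Variable mu : {finite_measure set (borelType X) -> \bar R}.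
Variables (df C : R).
Hypotheses (df_gt0 : 0 < df) (C_ge1 : 1 <= C).
Hypothesis regular : forall x (r : R), 0 <= r < diam X ->
    ((C^-1 * r `^ df)%:E <= mu (mclosed_ball x r) <= (C * r `^ df)%:E)%E.
Hypothesis diam_gt0 : 0 < diam X.

Definition separated (r : R) := pairwise (fun x y => r < mdist x y).

(** The balls of radius [r / 2] are disjoint by the triangle inequality, and [r / 2] is strictly
    below the diameter, so lower regularity applies to each. *)
Lemma separated_measure (r : R) (s : seq X) : 0 < r <= diam X -> separated r s ->
  (((size s)%:R * (C^-1 * (r / 2) `^ df))%:E <=
   mu (\big[setU/set0]_(x <- s) mclosed_ball x (r / 2)))%E.
Proof.
move=> /andP[r0 rX]; elim: s => [|x s ih].
  by rewrite big_nil mul0r measure0.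
rewrite /separated pairwise_cons => /andP[xs ss]; rewrite big_cons.
rewrite measureU; last 3 first.
- exact: mclosed_ball_measurable.
- by apply: bigsetU_measurable => y _; exact: mclosed_ball_measurable.
- rewrite -subset0 => y [xy]; rewrite -bigcup_seq => -[z zs zy].
  have := allP xs _ zs; rewrite ltNge => /negP; apply.
  rewrite (le_trans (metric_triangle _ y _))// [leRHS]splitr lerD//.
  by rewrite metric_sym.
rewrite /= -add1n natrD mulrDl mul1r EFinD leeD ?ih//.
have r2 : 0 <= r / 2 < diam X by apply/andP; split; lra.
by case/andP: (regular x r2).
Qed.

Lemma separated_size (r : R) (s : seq X) : 0 < r <= diam X -> separated r s ->
  (size s)%:R * (C^-1 * (r / 2) `^ df) <= fine (mu setT).
Proof.
move=> r0 ss; rewrite -lee_fin fineK ?fin_num_measure//.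
apply: (le_trans (separated_measure r0 ss)).
apply: le_measure => //; apply/mem_set; last exact: measurableT.
by apply: bigsetU_measurable => y _; exact: mclosed_ball_measurable.
Qed.

(** Sizes of separated sequences are bounded by [separated_size], so a longest one exists; a point
    farther than [r] from all its members could be added to it. *)
Lemma maximal_separated (r : R) : 0 < r <= diam X ->
  exists2 s, separated r s & forall y, exists2 x, x \in s & mdist x y <= r.
Proof.
move=> r0; pose P n := `[< exists2 s : seq X, size s = n & separated r s >].
have exP : exists n, P n by exists 0%N; apply/asboolP; exists [::].
have c0 : 0 < C^-1 * (r / 2) `^ df.
  case/andP: r0 => r0 _; apply: mulr_gt0; first by rewrite invr_gt0 (lt_le_trans ltr01 C_ge1).
  by apply: powR_gt0; lra.
pose b := Num.bound (fine (mu setT) / (C^-1 * (r / 2) `^ df)).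
have ubP n : P n -> (n <= b)%N.
  move=> /asboolP[s <- ss]; rewrite -(ler_nat R) ltW//.
  apply: le_lt_trans (archi_boundP _); last by rewrite divr_ge0 ?fine_ge0// ltW.
  by rewrite ler_pdivlMr// separated_size.
case: (ex_maxnP exP ubP) => n /asboolP[s sn ss] nmax; exists s => // y.
apply: contrapT => ny; suff : (n.+1 <= n)%N by rewrite ltnn.
apply: nmax; apply/asboolP; exists (y :: s); first by rewrite /= sn.
rewrite /separated pairwise_cons; apply/andP; split => //.
apply/allP => x xs; rewrite ltNge; apply/negP => yx; apply: ny.
by exists x => //; rewrite metric_sym.
Qed.

(* The cells are the balls around a maximal separated set, made disjoint. The
   balls of half the radius are already disjoint, whence the bound on [N]. *)
Lemma ball_partition (r : R) : 0 < r <= diam X ->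
  exists N (c : 'I_N -> X) (B : 'I_N -> set (borelType X)),
  [/\ forall j, measurable (B j), trivIset setT B,
      forall y, exists j, B j y, forall j y, B j y -> mdist (c j) y <= r &
      N%:R * (C^-1 * (r / 2) `^ df) <= fine (mu setT)].
Proof.
move=> r0; have [s ss scov] := maximal_separated r0.
pose F n : set (borelType X) :=
  if (n < size s)%N then mclosed_ball (nth point s n) r else set0.
have mF n : measurable (F n).
  by rewrite /F; case: ifP => // _; exact: mclosed_ball_measurable.
exists (size s), (fun j => nth point s j), (fun j => seqDU F j); split.
- by move=> j; exact: seqDU_measurable.
- by move=> i j _ _ /(@trivIset_seqDU _ F i j I I) => ij; exact: val_inj.
- move=> y; have [x xs xy] := scov y.
  have : (\bigcup_n F n) y.
    exists (index x s) => //; rewrite /F index_mem xs /mclosed_ball/=.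
    by rewrite nth_index.
  rewrite seqDU_bigcup_eq => -[n _ yn].
  have := subset_seqDU yn; rewrite /F; case: ifP => // ns _.
  by exists (Ordinal ns).
- by move=> j y yj; have := subset_seqDU yj; rewrite /F ltn_ord.
- exact: separated_size.
Qed.

(** Regularity is assumed only for radii below the diameter. The second term extends the upper bound
    to all larger radii, where the total mass bounds the measure of the ball. *)
Definition upper_cst := Num.max C (fine (mu setT) / diam X `^ df).

Lemma upper_cst_gt0 : 0 < upper_cst.
Proof. by rewrite lt_max (lt_le_trans ltr01 C_ge1). Qed.

Lemma upper_regular x (r : R) : 0 <= r ->
  (mu (mclosed_ball x r) <= (upper_cst * r `^ df)%:E)%E.
Proof.
move=> r0; have [rX|Xr] := ltP r (diam X).
  have rr : 0 <= r < diam X by rewrite r0.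
  case/andP: (regular x rr) => _ /le_trans; apply.
  by rewrite lee_fin ler_wpM2r ?powR_ge0// le_max lexx.
apply: (@le_trans _ _ (mu setT)).
  apply: le_measure => //; apply/mem_set; last exact: measurableT.
  exact: mclosed_ball_measurable.
rewrite -[leLHS]fineK ?fin_num_measure// lee_fin.
apply: (@le_trans _ _ (fine (mu setT) / diam X `^ df * r `^ df)).
  rewrite -mulrA ler_peMr ?fine_ge0// ler_pdivlMl ?powR_gt0// mulr1.
  by rewrite ge0_ler_powR ?nnegrE ?(ltW df_gt0)// ltW.
by rewrite ler_wpM2r ?powR_ge0// le_max lexx orbT.
Qed.

(** The function is dominated by the sum of [c j] times the indicator of the ball of radius [r j],
    and the integrals of these terms are dominated by a geometric series. Small balls serve near the
    diagonal, large ones away from it. *)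
Lemma dyadic_integral x (f : X -> R) (c r : nat -> R) (M q : R) :
  measurable_fun setT (f : borelType X -> R) -> (forall y, 0 <= f y) ->
  (forall j, 0 <= c j) -> (forall j, 0 <= r j) -> 0 <= q < 1 ->
  (forall j, c j * r j `^ df <= M * q ^+ j) ->
  (forall y, f y = 0 \/ exists2 j, mdist x y <= r j & f y <= c j) ->
  (\int[mu]_y (f y)%:E <= (upper_cst * M / (1 - q))%:E)%E.
Proof.
move=> mf f0 c0 r0 /andP[q0 q1] crM fc.
pose g j (y : borelType X) := (c j * \1_(mclosed_ball x (r j)) y)%:E.
have mg j : measurable_fun setT (g j).
  apply/measurable_EFinP; apply: measurable_funM => //.
  by apply: measurable_indic; exact: mclosed_ball_measurable.
have g0 j y : (0 <= g j y)%E by rewrite lee_fin mulr_ge0.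
apply: (@le_trans _ _ (\int[mu]_y (\sum_(j <oo) g j y))%E).
  apply: ge0_le_integral => //.
  - by move=> y _; rewrite lee_fin.
  - exact/measurable_EFinP.
  - by apply: ge0_emeasurable_sum => // *; exact: mg.
  move=> y _; case: (fc y) => [->|[j xy fy]]; first exact: nneseries_ge0.
  apply: (@le_trans _ _ (\sum_(0 <= i < j.+1) g i y)%E); last exact: nneseries_lim_ge.
  rewrite big_nat_recr//=; apply: (@le_trans _ _ (g j y)); last first.
    by rewrite leeDr// sume_ge0.
  by rewrite lee_fin indicE mem_set// mulr1.
rewrite integral_nneseries//.
apply: (@le_trans _ _ (\sum_(j <oo) ((upper_cst * M) * q ^+ j)%:E)%E); last first.
  by rewrite eseries_geometric.
apply: lee_nneseries => [j _ _|j _]; first exact: integral_ge0.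
rewrite /g; under eq_integral do rewrite EFinM.
rewrite ge0_integralZl_EFin//; last first.
  by apply/measurable_EFinP/measurable_indic; exact: mclosed_ball_measurable.
rewrite integral_indic//; last exact: mclosed_ball_measurable.
rewrite setIT; apply: (@le_trans _ _ ((c j)%:E * (upper_cst * r j `^ df)%:E)%E).
  by rewrite lee_wpmul2l ?lee_fin// upper_regular.
by rewrite -EFinM lee_fin mulrCA -mulrA ler_wpM2l// ltW// upper_cst_gt0.
Qed.

Local Notation Y := (borelType X).
Implicit Type k : Y -> Y -> R.

Lemma step_kernelE N (B : 'I_N -> set Y) (g : 'I_N -> Y -> R) j x y :
  trivIset setT B -> B j x -> step_kernel B g x y = g j y.
Proof.
move=> tB Bx; rewrite /step_kernel (bigD1 j)//= big1 ?addr0.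
  by rewrite indicE mem_set// mul1r.
move=> i ij; rewrite indicE memNset ?mul0r// => Bix.
by move/eqP: ij; apply; apply: tB => //; exists x.
Qed.

Lemma step_kernel_measurable N (B : 'I_N -> set Y) (g : 'I_N -> Y -> R) :
  (forall j, measurable (B j)) -> (forall j, measurable_fun setT (g j)) ->
  jointly_measurable (step_kernel B g).
Proof.
move=> mB mg; rewrite /jointly_measurable /step_kernel.
apply: measurable_sum => j; apply: measurable_funM.
  by apply: (measurableT_comp _ measurable_fst); apply: measurable_indic; exact: mB.
exact: (measurableT_comp _ measurable_snd).
Qed.

(** Freeze the first variable at the centre of its cell. *)
Lemma step_approx k (r e : R) : 0 < r <= diam X ->
  (forall x, measurable_fun setT (k x)) ->
  (forall x x' y : X, mdist x x' <= r -> `|k x y - k x' y| <= e) ->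
  exists N (c : 'I_N -> X) (B : 'I_N -> set Y),
  [/\ forall j, measurable (B j), trivIset setT B,
      forall x y, `|k x y - step_kernel B (fun j => k (c j)) x y| <= e &
      N%:R * (C^-1 * (r / 2) `^ df) <= fine (mu setT)].
Proof.
move=> r0 mk ke.
have [N [c [B [mB tB cB Bc NN]]]] := ball_partition r0.
exists N, c, B; split => // x y.
have [j xj] := cB x; rewrite (step_kernelE _ _ tB xj).
by apply: ke; rewrite metric_sym Bc.
Qed.

(** The kernel is a limit of step kernels, which are measurable for the product of the Borel
    sigma-algebras; no comparison with the Borel sets of the product space is involved. *)
Lemma modulus_jointly_measurable k :
  (forall x, measurable_fun setT (k x)) ->
  (forall e : R, 0 < e -> exists2 r : R, 0 < r &
    forall x x' y : X, mdist x x' <= r -> `|k x y - k x' y| <= e) ->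
  jointly_measurable k.
Proof.
move=> mk ke.
have /choice[s sP] n : exists s : Y -> Y -> R, jointly_measurable s /\
    forall x y, `|k x y - s x y| <= n.+1%:R^-1.
  have [|r r0 kr] := ke n.+1%:R^-1; first by rewrite invr_gt0.
  have r0' : 0 < Num.min r (diam X) <= diam X by rewrite lt_min r0 diam_gt0 ge_min lexx orbT.
  have [x x' y xx'|N [c [B [mB tB Bk _]]]] := step_approx r0' mk (e := n.+1%:R^-1).
    by apply: kr; rewrite (le_trans xx')// ge_min lexx.
  exists (step_kernel B (fun j => k (c j))); split => //.
  exact: step_kernel_measurable.
apply: (@measurable_fun_cvg _ _ _ setT (fun n (z : Y * Y) => s n z.1 z.2)).
  by move=> n; exact: (sP n).1.
move=> z _; apply/cvgrPdist_le => e e0.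
have : \forall n \near \oo, n.+1%:R^-1 <= e.
  near=> n; apply/ltW; near: n; exact: near_infty_natSinv_lt (PosNum e0).
by apply: filterS => n; apply: le_trans; exact: (sP n).2.
Unshelve. all: by end_near. Qed.

Lemma modulus_measurable (u : X -> R) :
  (forall e : R, 0 < e -> exists2 r : R, 0 < r &
    forall x x' : X, mdist x x' <= r -> `|u x - u x'| <= e) ->
  measurable_fun setT (u : Y -> R).
Proof.
move=> ue; have mk : jointly_measurable (fun x _ : Y => u x).
  apply: modulus_jointly_measurable => [x|e e0]; first exact: measurable_cst.
  by have [r r0 ur] := ue _ e0; exists r => // x x' _; exact: ur.
exact: jointly_measurable2 mk point.
Qed.

Lemma mdist_modulus (x x' y : X) : `|mdist x y - mdist x' y| <= mdist x x'.
Proof.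
rewrite ler_norml; apply/andP; split.
  by have := metric_triangle x' x y; rewrite (metric_sym x' x); lra.
by have := metric_triangle x x' y; lra.
Qed.

Lemma mdist_jointly_measurable : jointly_measurable (fun x y : Y => mdist (x : X) y).
Proof.
apply: modulus_jointly_measurable => [x|e e0].
  apply: modulus_measurable => e e0; exists e => // y y'; apply: le_trans.
  by rewrite !(metric_sym x) mdist_modulus.
by exists e => // x x' y; apply: le_trans; exact: mdist_modulus.
Qed.

Lemma holder_measurable (beta L : R) (h : X -> R) : 0 < beta -> 0 < L ->
  (forall x y, `|h x - h y| <= L * mdist x y `^ beta) ->
  measurable_fun setT (h : Y -> R).
Proof.
move=> b0 L0 hL; apply: modulus_measurable => e e0.
(* The radius at which the Hölder bound equals [e]. *)
exists ((e / L) `^ beta^-1); first by apply: powR_gt0; exact: divr_gt0.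
move=> x x' xx'; rewrite (le_trans (hL _ _))//.
apply: (@le_trans _ _ (L * ((e / L) `^ beta^-1) `^ beta)).
  by rewrite ler_wpM2l ?(ltW L0)// ge0_ler_powR ?nnegrE ?(ltW b0) ?powR_ge0 ?mdist_ge0.
have eL : 0 <= e / L by rewrite divr_ge0 ?ltW.
rewrite -powRrM mulVf ?(gt_eqF b0)// powRr1//.
by rewrite mulrC divfK// (gt_eqF L0).
Qed.

End geometry.

(** * The kernel and its truncations *)

Section real_powers.
Variable R : realType.
Implicit Types a b m s t : R.

Lemma le0_ler_powR t a b : t <= 0 -> 0 < a -> a <= b -> b `^ t <= a `^ t.
Proof.
move=> t0 a0 ab; rewrite -(opprK t) !(powRN _ (- t)).
have b0 := lt_le_trans a0 ab.
rewrite lef_pV2 ?posrE ?powR_gt0// ge0_ler_powR ?nnegrE ?oppr_ge0//; exact: ltW.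
Qed.

(** A derivative-free mean value bound: for [t = b / a], the inequalities [1 + x <= exp x] and
    [ln (1 + x) <= x] give [1 - s (t - 1) <= t^(-s)]. *)
Lemma powRN_lipschitz s m a b : 0 < s -> 0 < m -> m <= a -> m <= b ->
  `|a `^ (- s) - b `^ (- s)| <= s * `|a - b| * m `^ (- s - 1).
Proof.
move=> s0 m0; wlog ab : a b / a <= b.
  move=> H ma mb; have [ab|/ltW ba] := leP a b; first exact: H.
  by rewrite distrC (distrC a); exact: H.
move=> ma mb; have a0 := lt_le_trans m0 ma; have b0 := lt_le_trans m0 mb.
have t0 : 0 < b / a by exact: divr_gt0.
rewrite ger0_norm; last by rewrite subr_ge0 le0_ler_powR// oppr_le0 ltW.
rewrite distrC ger0_norm ?subr_ge0//.
have H : 1 - s * (b / a - 1) <= (b / a) `^ (- s).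
  rewrite /powR gt_eqF//; apply: le_trans (expR_ge1Dx _).
  rewrite lerD2l mulNr lerN2 ler_pM2l//.
  rewrite -[X in ln X](subrKC 1); apply: le_ln1Dx; lra.
apply: (@le_trans _ _ (s * (b - a) * a `^ (- s - 1))); last first.
  rewrite ler_wpM2l ?mulr_ge0 ?(ltW s0) ?subr_ge0//.
  by rewrite le0_ler_powR//; lra.
have -> : b `^ (- s) = a `^ (- s) * (b / a) `^ (- s).
  by rewrite -powRM ?(ltW a0) ?(ltW t0)// mulrCA divff ?gt_eqF// mulr1.
have -> : a `^ (- s - 1) = a `^ (- s) / a.
  rewrite powRD; last by rewrite (gt_eqF a0) implybT.
  by rewrite powR_inv1// ltW.
have p0 := powR_ge0 a (- s).
rewrite -subr_ge0 (_ : _ - _ =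
  a `^ (- s) * ((b / a) `^ (- s) - (1 - s * (b / a - 1)))).
  by rewrite mulr_ge0// subr_ge0.
by field; rewrite gt_eqF.
Qed.

Lemma dyadic_nat t : 1 <= t -> exists j, 2 ^+ j <= t < 2 ^+ j.+1.
Proof.
move=> t1; have t0 : 0 <= t by lra.
have /andP[nt tn] := truncn_itv t0.
set n := Num.truncn t in nt tn.
have n0 : (0 < n)%N by rewrite lt0n; apply/eqP => n0; move: tn; rewrite n0; lra.
have /andP[jn nj] := trunc_log_bounds (isT : (1 < 2)%N) n0.
exists (trunc_log 2 n); apply/andP; split.
  by rewrite (le_trans _ nt)// -natrX ler_nat.
by rewrite (lt_le_trans tn)// -natrX ler_nat.
Qed.

Lemma powR_expr a t j : 0 <= a -> (a ^+ j) `^ t = (a `^ t) ^+ j.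
Proof. by move=> a0; rewrite -!powR_mulrn ?powR_ge0// powRAC. Qed.

End real_powers.

Section kernel_estimates.
Context (R : realType) (X : pointedMetricType R).
Hypothesis X_compact : compact [set: X].
Variable mu : {finite_measure set (borelType X) -> \bar R}.
Variables (df C : R).
Hypotheses (df_gt0 : 0 < df) (C_ge1 : 1 <= C).
Hypothesis regular : forall (x : X) (r : R), 0 <= r < diam X ->
    ((C^-1 * r `^ df)%:E <= mu (mclosed_ball x r) <= (C * r `^ df)%:E)%E.
Hypothesis diam_gt0 : 0 < diam X.
Variables (alpha beta L : R) (h : X -> R).
Hypotheses (alpha_gt0 : 0 < 2 * alpha) (alpha_beta : 2 * alpha < beta).
Hypotheses (beta_le1 : beta <= 1) (L_gt0 : 0 < L).
Hypothesis hL : forall x y, `|h x - h y| <= L * mdist x y `^ beta.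

Local Notation Y := (borelType X).
Local Notation s := (df + 2 * alpha).
Local Notation K := (K_kernel df alpha h : Y -> Y -> R).
Implicit Types x y : X.

Let s_gt0 : 0 < s. Proof. by rewrite addr_gt0. Qed.
Let Ns_le0 : - s <= 0. Proof. by rewrite oppr_le0 ltW. Qed.
Let beta_gt0 : 0 < beta. Proof. exact: lt_trans alpha_gt0 alpha_beta. Qed.

Definition truncated_kernel (delta : R) x y : R :=
  (h x - h y) * Num.max (mdist x y) delta `^ (- s).

Lemma K_kernelE x y : K x y = (h x - h y) * mdist x y `^ (- s).
Proof. by rewrite powRN. Qed.

Lemma holder_diag x y : mdist x y = 0 -> h x - h y = 0.
Proof.
move=> d0; apply/eqP; rewrite -normr_le0 (le_trans (hL _ _))//.
by rewrite d0 powR0 ?mulr0// gt_eqF.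
Qed.

Lemma K_kernel_le x y : `|K x y| <= L * mdist x y `^ (beta - s).
Proof.
rewrite K_kernelE normrM (ger0_norm (powR_ge0 _ _)).
(* Splitting the exponent needs a nonzero base; at distance 0 the difference of values of [h]
   vanishes. *)
have [d0|d0] := eqVneq (mdist x y) 0.
  by rewrite holder_diag// normr0 mul0r mulr_ge0 ?(ltW L_gt0)// powR_ge0.
rewrite (powRD (x := mdist x y) (r := beta)) ?d0 ?implybT// mulrA.
by rewrite ler_wpM2r ?powR_ge0.
Qed.

Section truncation.
Variable delta : R.
Hypothesis delta_gt0 : 0 < delta.
Local Notation Kd := (truncated_kernel delta).
Local Notation m x y := (Num.max (mdist x y) delta).

Let m_gt0 x y : 0 < m x y. Proof. by rewrite lt_max delta_gt0 orbT. Qed.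
Let delta_le_m x y : delta <= m x y. Proof. by rewrite le_max lexx orbT. Qed.
Let dist_le_m x y : mdist x y <= m x y. Proof. by rewrite le_max lexx. Qed.

Let holder_m x y : `|h x - h y| <= L * m x y `^ beta.
Proof.
rewrite (le_trans (hL x y))// ler_wpM2l ?(ltW L_gt0)//.
by rewrite ge0_ler_powR ?nnegrE ?mdist_ge0 ?(ltW beta_gt0) ?(ltW (m_gt0 _ _)).
Qed.

Lemma truncated_kernel_le x y : `|Kd x y| <= L * m x y `^ (beta - s).
Proof.
rewrite normrM (ger0_norm (powR_ge0 _ _)) (powRD (x := m x y) (r := beta)).
  by rewrite mulrA ler_wpM2r ?powR_ge0.
by rewrite (gt_eqF (m_gt0 x y)) implybT.
Qed.

(** The kernels agree from distance [delta] on; below it the two powers differ by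
    [d^(-s) - delta^(-s)], which lies between 0 and [d^(-s)]. *)
Lemma sub_truncated_kernel_le x y :
  `|K x y - Kd x y| <= if mdist x y < delta then L * mdist x y `^ (beta - s) else 0.
Proof.
rewrite K_kernelE /truncated_kernel -mulrBr.
case: ltP => d; last by rewrite subrr mulr0 normr0.
have [d0|d0] := eqVneq (mdist x y) 0.
  by rewrite holder_diag// mul0r normr0 mulr_ge0 ?(ltW L_gt0)// powR_ge0.
have dp : 0 < mdist x y by rewrite lt_def d0 mdist_ge0.
rewrite normrM (powRD (x := mdist x y) (r := beta)) ?d0 ?implybT// mulrA.
apply: ler_pM => //.
rewrite ger0_norm; first by rewrite gerBl powR_ge0.
by rewrite subr_ge0 le0_ler_powR// ltW.
Qed.

(* The [r]-oscillation of the truncated kernel: below the truncation scale the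
   Lipschitz bound of the power is traded for the Hoelder exponent of [h]. *)
Lemma truncated_kernel_osc (r : R) x x' y : 0 < r <= delta -> mdist x x' <= r ->
  `|Kd x y - Kd x' y| <= L * (1 + s * 2 `^ (s + 1)) * (r `^ beta * delta `^ (- s)).
Proof.
move=> /andP[r0 rd] xx'.
have -> : Kd x y - Kd x' y = (h x - h x') * m x y `^ (- s) +
    (h x' - h y) * (m x y `^ (- s) - m x' y `^ (- s)).
  by rewrite /truncated_kernel; ring.
have -> w z : L * (1 + w) * z = L * z + L * w * z by ring.
rewrite (le_trans (ler_normD _ _))// lerD//.
  rewrite normrM (ger0_norm (powR_ge0 _ _)) mulrA ler_pM ?powR_ge0//.
    rewrite (le_trans (hL x x'))// ler_wpM2l ?(ltW L_gt0)//.
    by rewrite ge0_ler_powR ?nnegrE ?mdist_ge0 ?(ltW beta_gt0) ?(ltW r0).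
  by rewrite le0_ler_powR.
have mm : `|m x y - m x' y| <= r.
  have := le_trans (mdist_modulus x x' y) xx'.
  rewrite !ler_norml /Num.max; case: ltP => ?; case: ltP => ? /andP[? ?];
    apply/andP; split; lra.
(* The truncated distances differ by at most [r <= delta <= m x y], so they are comparable up to a
   factor 2. *)
have m2 : m x' y / 2 <= m x y.
  by have := delta_le_m x y; move: mm; rewrite ler_norml => /andP[]; lra.
have mh : m x' y / 2 <= m x' y by have := m_gt0 x' y; lra.
rewrite normrM; apply: (@le_trans _ _ ((L * m x' y `^ beta) *
    (s * r * (m x' y / 2) `^ (- s - 1)))).
  apply: ler_pM => //; apply: le_trans (powRN_lipschitz s_gt0 _ m2 mh) _.
    by rewrite divr_gt0.
  by rewrite ler_wpM2r ?powR_ge0// ler_wpM2l// ltW.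
have -> : (m x' y / 2) `^ (- s - 1) = m x' y `^ (- s - 1) * 2 `^ (s + 1).
  rewrite powRM ?(ltW (m_gt0 x' y))//; congr (_ * _).
  by rewrite -powR_inv1// -powRrM; congr (_ `^ _); ring.
have -> : L * m x' y `^ beta * (s * r * (m x' y `^ (- s - 1) * 2 `^ (s + 1))) =
    L * (s * 2 `^ (s + 1)) * (r * m x' y `^ (beta - 1 - s)).
  have -> : beta - 1 - s = beta + (- s - 1) by ring.
  rewrite (powRD (x := m x' y)) ?(gt_eqF (m_gt0 x' y)) ?implybT//; ring.
rewrite ler_wpM2l ?mulr_ge0 ?powR_ge0 ?(ltW L_gt0) ?(ltW s_gt0)//.
(* The exponent is negative and the truncated distance is at least [delta]. *)
apply: (@le_trans _ _ (r * delta `^ (beta - 1 - s))).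
  by rewrite ler_wpM2l ?(ltW r0)// le0_ler_powR//; have := s_gt0; have := beta_le1; lra.
rewrite powRD ?(gt_eqF delta_gt0) ?implybT// mulrA ler_wpM2r ?powR_ge0//.
(* Here [beta <= 1] and [r <= delta] turn a power of [delta] into one of [r]. *)
apply: (@le_trans _ _ (r * r `^ (beta - 1))).
  by rewrite ler_wpM2l ?(ltW r0)// le0_ler_powR//; have := beta_le1; lra.
by rewrite mulr_powRB1// ltW.
Qed.

End truncation.

Lemma K_kernel_measurable : jointly_measurable (K : Y -> Y -> R).
Proof.
rewrite /jointly_measurable; under eq_fun do rewrite K_kernelE.
have mh := holder_measurable C_ge1 regular diam_gt0 beta_gt0 L_gt0 hL.
apply: measurable_funM.
  apply: measurable_funB.
    exact: (measurableT_comp mh measurable_fst).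
  exact: (measurableT_comp mh measurable_snd).
apply: (measurableT_comp (measurable_powR _)).
exact: (mdist_jointly_measurable C_ge1 regular diam_gt0).
Qed.

Lemma truncated_kernel_measurable delta :
  jointly_measurable (truncated_kernel delta : Y -> Y -> R).
Proof.
have mh := holder_measurable C_ge1 regular diam_gt0 beta_gt0 L_gt0 hL.
apply: measurable_funM.
  apply: measurable_funB.
    exact: (measurableT_comp mh measurable_fst).
  exact: (measurableT_comp mh measurable_snd).
apply: (measurableT_comp (measurable_powR _)).
apply: measurable_maxr => //.
exact: (mdist_jointly_measurable C_ge1 regular diam_gt0).
Qed.

Local Notation gamma := (beta - 2 * alpha).
Local Notation D := (Num.max 1 (diam X)).
Local Notation Cu := (upper_cst mu df C).

Let L0 : 0 <= L. Proof. exact: ltW. Qed.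
Let Cu0 : 0 <= Cu. Proof. by rewrite ltW// upper_cst_gt0. Qed.
Let D1 : 1 <= D. Proof. by rewrite le_max lexx. Qed.
Let D0 : 0 <= D. Proof. exact: le_trans ler01 D1. Qed.
Let distD x y : mdist x y <= D.
Proof. by rewrite le_max mdist_le_diam ?orbT. Qed.

(** On a bounded range the exponent [gamma] can be lowered to [g] at the cost of a constant. Since
    [D] is at least 1, it also bounds distances truncated at a scale at most 1. *)
Let beta_s (g t : R) : 0 < t -> t <= D -> g <= gamma ->
  t `^ (beta - s) <= D `^ (gamma - g) * t `^ (g - df).
Proof.
move=> t0 tD gg; have -> : beta - s = (gamma - g) + (g - df) by ring.
rewrite (powRD (x := t)) ?(gt_eqF t0) ?implybT// ler_wpM2r ?powR_ge0//.
by rewrite ge0_ler_powR ?nnegrE ?subr_ge0// ltW.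
Qed.

(** The outcome of [dyadic_integral] for the radii [delta * 2^-j], with geometric ratio
    [2^(- g)]. *)
Definition near_cst (g : R) := Cu * (D `^ (gamma - g) * 2 `^ (df - g)) / (1 - 2 `^ (- g)).

Lemma near_cst_gt0 g : 0 < g -> 0 < near_cst g.
Proof.
move=> g0; rewrite /near_cst !mulr_gt0 ?upper_cst_gt0 ?powR_gt0//.
  exact: lt_le_trans ltr01 D1.
by rewrite invr_gt0 subr_gt0 powR2_lt1// oppr_lt0.
Qed.

(** The difference lives below distance [delta]; decompose this ball into the annuli between
    [delta * 2^-(j+1)] and [delta * 2^-j]. The columns follow from the rows because the absolute
    value of the kernel is symmetric. *)
Lemma near_diagonal_schur (g delta : R) : 0 < g -> g <= gamma -> g < df -> 0 < delta ->
  schur_bound mu (fun x y : Y => K x y - truncated_kernel delta x y)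
    (near_cst g * L * delta `^ g).
Proof.
move=> g0 gg gdf d0.
have mK := K_kernel_measurable.
have mT := truncated_kernel_measurable delta.
have mKT : jointly_measurable (fun x y : Y => K x y - truncated_kernel delta x y).
  exact: measurable_funB.
have q1 : 2 `^ (- g) < 1 :> R by rewrite powR2_lt1// oppr_lt0.
have intx x : (\int[mu]_y `|K x y - truncated_kernel delta x y|%:E <=
    (near_cst g * L * delta `^ g)%:E)%E.
  have -> : near_cst g * L * delta `^ g =
      Cu * (L * D `^ (gamma - g) * 2 `^ (df - g) * delta `^ g) / (1 - 2 `^ (- g)).
    by rewrite /near_cst; field; rewrite gt_eqF// subr_gt0.
  have [r rE] : exists r : nat -> R, forall j, r j = delta * 2^-1 ^+ j.
    by exists (fun j => delta * 2^-1 ^+ j).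
  have r_gt0 j : 0 < r j by rewrite rE mulr_gt0// exprn_gt0.
  apply: (@dyadic_integral _ _ mu df C df_gt0 C_ge1 regular diam_gt0 x _
    (fun j => L * D `^ (gamma - g) * (r j / 2) `^ (g - df)) r).
  - by apply: measurableT_comp => //; exact: jointly_measurable1 mKT x.
  - by move=> y.
  - by move=> j; rewrite !mulr_ge0 ?powR_ge0.
  - by move=> j; exact: ltW.
  - by rewrite powR_ge0.
  - move=> j; rewrite -!mulrA ler_wpM2l// ler_wpM2l ?powR_ge0//.
    rewrite powRM ?(ltW (r_gt0 j))//.
    have -> : 2^-1 `^ (g - df) = 2 `^ (df - g) :> R.
      by rewrite -powR_inv1// -powRrM; congr (_ `^ _); ring.
    rewrite mulrAC -(powRD (x := r j)) ?(gt_eqF (r_gt0 j)) ?implybT//.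
    have -> : g - df + df = g by ring.
    rewrite mulrC ler_wpM2l ?powR_ge0// rE powRM ?exprn_ge0 ?(ltW d0)//.
    by rewrite powR_expr// -powR_inv1// -powRrM mulN1r.
  - move=> y; have [dxy|dxy] := eqVneq (mdist x y) 0.
      left; rewrite K_kernelE /truncated_kernel.
      by rewrite (holder_diag dxy) !mul0r subrr normr0.
    have dp : 0 < mdist x y by rewrite lt_def dxy mdist_ge0.
    have := sub_truncated_kernel_le delta x y.
    case: ifP => [dd H|_ H]; last by left; apply/eqP; rewrite -normr_le0 normr_id.
    have [|j /andP[j1 j2]] := @dyadic_nat _ (delta / mdist x y).
      by rewrite ler_pdivlMr// mul1r ltW.
    have p0 : 0 < 2 ^+ j :> R by rewrite exprn_gt0.
    right; exists j.
      rewrite rE exprVn ler_pdivlMr// mulrC.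
      by move: j1; rewrite ler_pdivlMr.
    apply: (le_trans H); rewrite -mulrA ler_wpM2l//.
    apply: (le_trans (beta_s dp (distD x y) gg)).
    rewrite ler_wpM2l ?powR_ge0// le0_ler_powR ?divr_gt0//; first by rewrite subr_le0 ltW.
    rewrite rE exprVn ltW// ltr_pdivrMr// ltr_pdivrMr//.
    move: j2; rewrite ltr_pdivrMr// exprS; lra.
split.
- apply: mulr_gt0; last exact: powR_gt0.
  by apply: mulr_gt0 => //; exact: near_cst_gt0.
- exact: mKT.
- exact: intx.
- move=> y; apply: le_trans (intx y); rewrite le_eqVlt; apply/orP; left; apply/eqP.
  apply: eq_integral => x _; congr (_%:E).
  rewrite !K_kernelE /truncated_kernel (metric_sym x y) -!mulrBr !normrM.
  by rewrite distrC.
Qed.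

(** The outcome of [dyadic_integral] for the radii [2 * delta * 2^j], with ratio [2^(2 g - df)]. *)
Definition far_cst (g : R) :=
  Cu * (D `^ (gamma - g) ^+ 2 * 2 `^ df) / (1 - 2 `^ (2 * g - df)).

Lemma far_cst_ge0 g : 2 * g < df -> 0 <= far_cst g.
Proof.
move=> gdf; rewrite /far_cst !mulr_ge0 ?exprn_ge0 ?powR_ge0//.
by rewrite invr_ge0 subr_ge0 ltW// powR2_lt1// subr_lt0.
Qed.

(** Decompose according to the truncated distance, between [delta * 2^j] and [delta * 2^(j+1)]. As
    [2 g < df], the contributions decrease geometrically outwards and the scale [delta]
    dominates. *)
Lemma truncated_kernel_square (g delta : R) x : g <= gamma -> 2 * g < df -> 0 < delta <= 1 ->
  (\int[mu]_y (truncated_kernel delta x y ^+ 2)%:E <=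
    (far_cst g * L ^+ 2 * delta `^ (2 * g - df))%:E)%E.
Proof.
move=> gg gdf /andP[d0 d1].
have mT := truncated_kernel_measurable delta.
have q1 : 2 `^ (2 * g - df) < 1 :> R by rewrite powR2_lt1// subr_lt0.
have -> : far_cst g * L ^+ 2 * delta `^ (2 * g - df) =
    Cu * ((L * D `^ (gamma - g)) ^+ 2 * 2 `^ df * delta `^ (2 * g - df)) /
    (1 - 2 `^ (2 * g - df)).
  by rewrite /far_cst; field; rewrite gt_eqF// subr_gt0.
have [r rE] : exists r : nat -> R, forall j, r j = delta * 2 ^+ j.
  by exists (fun j => delta * 2 ^+ j).
have r_gt0 j : 0 < r j by rewrite rE mulr_gt0// exprn_gt0.
apply: (@dyadic_integral _ _ mu df C df_gt0 C_ge1 regular diam_gt0 x _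
  (fun j => (L * D `^ (gamma - g)) ^+ 2 * (r j) `^ (2 * (g - df))) (fun j => 2 * r j)).
- by apply: measurable_funX; exact: jointly_measurable1 mT x.
- by move=> y; rewrite sqr_ge0.
- by move=> j; rewrite mulr_ge0 ?sqr_ge0 ?powR_ge0.
- by move=> j; rewrite mulr_ge0// ltW.
- by rewrite powR_ge0.
- move=> j; have := sqr_ge0 (L * D `^ (gamma - g)).
  move: ((L * D `^ (gamma - g)) ^+ 2) => A A0; rewrite -!mulrA ler_wpM2l//.
  rewrite (powRM (x := 2)) ?(ltW (r_gt0 j))// mulrCA ler_wpM2l ?powR_ge0//.
  rewrite -(powRD (x := r j)) ?(gt_eqF (r_gt0 j)) ?implybT//.
  have -> : 2 * (g - df) + df = 2 * g - df by ring.
  by rewrite rE powRM ?exprn_ge0 ?(ltW d0)// powR_expr.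
move=> y; right; set m := Num.max (mdist x y) delta.
have m0 : 0 < m by rewrite lt_max d0 orbT.
have [|j /andP[j1 j2]] := @dyadic_nat _ (m / delta).
  by rewrite ler_pdivlMr// mul1r le_max lexx orbT.
exists j.
  apply: (@le_trans _ _ m); first by rewrite le_max lexx.
  move: j2; rewrite ltr_pdivrMr// exprS rE => H; apply: ltW; rewrite mulrCA mulrC.
  by rewrite (lt_le_trans H)// le_eqVlt; apply/orP; left; apply/eqP; ring.
have := truncated_kernel_le d0 x y.
have mD : m <= D by rewrite ge_max distD (le_trans d1 D1).
move=> /le_trans/(_ (ler_wpM2l L0 (beta_s m0 mD gg))) H.
rewrite -real_normK ?num_real//.
apply: (@le_trans _ _ ((L * (D `^ (gamma - g) * m `^ (g - df))) ^+ 2)).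
  rewrite ler_sqr ?nnegrE//; exact: le_trans (normr_ge0 _) H.
rewrite mulrA exprMn ler_wpM2l ?sqr_ge0//.
have -> : 2 * (g - df) = (g - df) * 2%:R by rewrite mulrC.
rewrite powRrM powR_mulrn ?powR_ge0// ler_sqr ?nnegrE ?powR_ge0//.
rewrite le0_ler_powR//; first by have := df_gt0; lra.
by move: j1; rewrite ler_pdivlMr// rE mulrC.
Qed.

Local Notation Kd delta := (truncated_kernel delta : Y -> Y -> R).
Local Notation m := (fine (mu setT)).

Let m_ge0 : 0 <= m. Proof. exact: fine_ge0. Qed.
Let mKd delta : jointly_measurable (Kd delta) :=
  truncated_kernel_measurable delta.
Let mK : jointly_measurable K :=
  K_kernel_measurable.

Lemma truncated_kernel_bounded (delta : R) : 0 < delta ->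
  forall x y, `|Kd delta x y| <= L * D `^ beta * delta `^ (- s).
Proof.
move=> d0 x y; rewrite /truncated_kernel normrM (ger0_norm (powR_ge0 _ _)).
apply: ler_pM; rewrite ?powR_ge0//.
  rewrite (le_trans (hL x y))// ler_wpM2l ?(ltW L_gt0)//.
  by rewrite ge0_ler_powR ?nnegrE ?mdist_ge0 ?(ltW beta_gt0).
by rewrite le0_ler_powR ?oppr_le0 ?(ltW s_gt0)// le_max lexx orbT.
Qed.

Let osc_cst := 1 + s * 2 `^ (s + 1).
Let osc_ge0 : 0 <= osc_cst.
Proof. by rewrite addr_ge0// mulr_ge0 ?powR_ge0// ltW. Qed.

Lemma truncated_step (delta r : R) : 0 < r <= delta -> r <= diam X ->
  exists N (c : 'I_N -> X) (B : 'I_N -> set Y),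
  [/\ forall j, measurable (B j), trivIset setT B,
      forall x y, `|Kd delta x y - step_kernel B (fun j => Kd delta (c j)) x y|
        <= L * osc_cst * (r `^ beta * delta `^ (- s)) &
      N%:R * (C^-1 * (r / 2) `^ df) <= m].
Proof.
move=> /andP[r0 rd] rX.
apply: (step_approx C_ge1 regular) => //; first by rewrite r0.
  by move=> x; exact: jointly_measurable1 (mKd delta) x.
move=> x x' y xx'; apply: truncated_kernel_osc => //.
- exact: (lt_le_trans r0).
- by rewrite r0.
Qed.

(** Half of [e] pays for the truncation, through [near_diagonal_schur], and half for the uniform
    step approximation of the bounded truncated kernel. *)
Lemma K_kernel_step (e : R) : 0 < e ->
  exists N (B : 'I_N -> set Y) (g : 'I_N -> Y -> R) (M : R),
    [/\ forall j, measurable (B j), trivIset setT B,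
        forall j, measurable_fun setT (g j), forall j y, `|g j y| <= M &
        schur_bound mu (fun x y => K x y - step_kernel B g x y) e].
Proof.
move=> e0; pose g0 := Num.min gamma (df / 2).
have g00 : 0 < g0 by rewrite lt_min subr_gt0 alpha_beta divr_gt0.
have g0g : g0 <= gamma by rewrite ge_min lexx.
have g0d : g0 < df.
  by apply: (@le_lt_trans _ _ (df / 2)); [rewrite ge_min lexx orbT|have := df_gt0; lra].
pose c := near_cst g0 * L.
have c0 : 0 < c by rewrite mulr_gt0// near_cst_gt0.
(* Solves [c * delta^g0 = e / 2]. *)
pose delta := (e / 2 / c) `^ g0^-1.
have d0 : 0 < delta by apply: powR_gt0; rewrite !divr_gt0.
have dE : c * delta `^ g0 = e / 2.
  rewrite -powRrM mulVf ?gt_eqF// powRr1 ?divr_ge0 ?(ltW c0) ?(ltW e0)//.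
  by rewrite mulrC divfK// gt_eqF.
pose eta := e / 2 / (m + 1).
have m1 : 0 < m + 1 by rewrite ltr_wpDl.
have eta0 : 0 < eta by rewrite !divr_gt0.
pose W := (L * osc_cst + 1) * delta `^ (- s).
have W0 : 0 < W.
  apply: mulr_gt0; last exact: powR_gt0.
  by rewrite ltr_wpDl// mulr_ge0// ltW.
(* Small enough for the oscillation bound [r^beta * W] to be at most [eta], the uniform error whose
   Schur bound is [e / 2]. *)
pose r := Num.min (Num.min delta (diam X)) ((eta / W) `^ beta^-1).
have r0 : 0 < r by rewrite !lt_min d0 diam_gt0 powR_gt0// divr_gt0.
have rd : r <= delta by rewrite !ge_min lexx.
have rX : r <= diam X by rewrite !ge_min lexx orbT.
have rW : r `^ beta <= eta / W.
  apply: (@le_trans _ _ (((eta / W) `^ beta^-1) `^ beta)).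
    by rewrite ge0_ler_powR ?nnegrE ?powR_ge0 ?(ltW r0) ?(ltW beta_gt0)// ge_min lexx orbT.
  by rewrite -powRrM mulVf ?(gt_eqF beta_gt0)// powRr1// divr_ge0// ltW.
have rd' : 0 < r <= delta by rewrite r0.
have [N [cc [B [mB tB KB _]]]] := truncated_step rd' rX.
have mS := step_kernel_measurable mB (fun j => jointly_measurable1 (mKd delta) (cc j)).
exists N, B, (fun j => Kd delta (cc j)), (L * D `^ beta * delta `^ (- s)); split => //.
- by move=> j; exact: jointly_measurable1 (mKd delta) (cc j).
- by move=> j y; exact: truncated_kernel_bounded.
have -> : e = c * delta `^ g0 + eta * (m + 1).
  by rewrite dE /eta divfK ?(gt_eqF m1)// -splitr.
have -> : (fun x y => K x y - step_kernel B (fun j => Kd delta (cc j)) x y) =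
   (fun x y => (K x y - Kd delta x y) +
     (Kd delta x y - step_kernel B (fun j => Kd delta (cc j)) x y)).
  by apply/funext => x; apply/funext => y; rewrite addrA subrK.
apply: schur_boundD.
  exact: (near_diagonal_schur g00 g0g g0d d0).
apply: bounded_schur => //; first exact: (measurable_funB (mKd delta) mS).
move=> x y; apply: (le_trans (KB x y)).
apply: (@le_trans _ _ (r `^ beta * W)); last by rewrite -ler_pdivlMr.
rewrite -subr_ge0 (_ : _ - _ = delta `^ (- s) * r `^ beta).
  by rewrite mulr_ge0 ?powR_ge0.
by rewrite /W; ring.
Qed.

(** A single step approximation with error 1 suffices. *)
Lemma K_kernel_schur : exists a, schur_bound mu K a.
Proof.
have [N [B [g [M [mB tB mg gM ke]]]]] := K_kernel_step ltr01.
have [a sa] := step_kernel_schur mu mB mg gM.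
exists (1 + a); have -> : K = (fun x y => (K x y - step_kernel B g x y) + step_kernel B g x y).
  by apply/funext => x; apply/funext => y; rewrite subrK.
exact: schur_boundD.
Qed.

Lemma K_operator_compact : compact_operator (K_operator mu df alpha h).
Proof.
have [a sa] := K_kernel_schur.
exact: integral_operator_compact sa K_kernel_step.
Qed.

Definition weak_cst (g : R) := Num.sqrt (2 *
  (near_cst g ^+ 2 + far_cst g * m)).

(** No finite rank part is used here: the kernel is its near-diagonal part plus its truncation, and
    [singular_value_step] is applied with an empty family of cells. *)
Lemma K_singular_value_weak (g : R) n : 0 < g -> g <= gamma -> 2 * g < df ->
  0 <= singular_value (K_operator mu df alpha h) n <=
  weak_cst g * L * n.+1%:R `^ (- (g / df)).
Proof.
move=> g0 gg gdf.
have far0 : 0 <= far_cst g by exact: far_cst_ge0.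
apply: singular_value_le => [|t u t0 ou ku].
  by rewrite !mulr_ge0 ?sqrtr_ge0 ?powR_ge0// ltW.
have n0 : (0 : R) < n.+1%:R by [].
(* Balances the Schur term [(n + 1) delta^(2 g)] with the Hilbert-Schmidt term
   [delta^(2 g - df)]. *)
pose delta : R := n.+1%:R `^ (- df^-1).
have d0 : 0 < delta by exact: powR_gt0.
have d1 : delta <= 1.
  rewrite /delta powRN invf_le1 ?powR_gt0// -[leLHS](powRr0 n.+1%:R).
  by rewrite ler_powR ?ler1n// invr_ge0 ltW.
have gdf' : g < df by lra.
have s1 := near_diagonal_schur g0 gg gdf' d0.
have Db : 0 < L * D `^ beta * delta `^ (- s).
  by rewrite !mulr_gt0 ?powR_gt0// lt_max ltr01.
have s2 := bounded_schur mu Db (mKd delta) (truncated_kernel_bounded d0).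
have d01 : 0 < delta <= 1 by rewrite d0.
have k2 x := truncated_kernel_square x gg gdf d01.
pose B : 'I_0 -> set Y := fun=> set0; pose G : 'I_0 -> Y -> R := fun=> cst 0.
have KE : K = (fun x y => step_kernel B G x y + ((K x y - Kd delta x y) + Kd delta x y)).
  by apply/funext => x; apply/funext => y; rewrite /step_kernel big_ord0 add0r subrK.
have mB (j : 'I_0) : measurable (B j) by exact: measurable0.
have tB : trivIset setT B by case.
have mG (j : 'I_0) : measurable_fun setT (G j) by exact: measurable_cst.
have GM (j : 'I_0) (y : Y) : `|G j y| <= 0 by rewrite normr0.
have := singular_value_step mB tB mG GM s1 s2 k2 KE t0 ou ku.
rewrite subr0 => H.
have dE : delta `^ (2 * g - df) = n.+1%:R * delta `^ g ^+ 2.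
  have -> : 2 * g - df = - df + g * 2%:R by ring.
  rewrite (powRD (x := delta)) ?(gt_eqF d0) ?implybT// powRrM powR_mulrn ?powR_ge0//.
  by rewrite /delta -[in LHS]powRrM mulrNN mulVf ?gt_eqF// powRr1.
have {}dg : delta `^ g = n.+1%:R `^ (- (g / df)).
  by rewrite /delta -powRrM mulNr mulrC.
rewrite -ler_sqr ?nnegrE ?(ltW t0)//; last first.
  by rewrite !mulr_ge0 ?sqrtr_ge0 ?powR_ge0// ltW.
rewrite !exprMn /weak_cst sqr_sqrtr; last first.
  by rewrite mulr_ge0// addr_ge0 ?sqr_ge0// mulr_ge0.
rewrite -(ler_pM2r n0); apply: (le_trans H).
rewrite dE -dg le_eqVlt; apply/orP; left; apply/eqP; ring.
Qed.

Local Notation eta := (beta - s).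

(** Rank at most half of [n + 1] leaves half of the singular vectors to a uniformly small remainder.
    Treating it as a Hilbert-Schmidt kernel gains the factor [(n + 1)^(-1/2)]. *)
Lemma K_singular_value_step (r : R) n N (B : 'I_N -> set Y) (g : 'I_N -> Y -> R) (M b : R) :
  (forall j, measurable (B j)) -> trivIset setT B ->
  (forall j, measurable_fun setT (g j)) -> (forall j y, `|g j y| <= M) ->
  0 < b -> (forall x y, `|K x y - step_kernel B g x y| <= b) ->
  2 * N%:R <= n.+1%:R :> R ->
  0 <= singular_value (K_operator mu df alpha h) n <=
  2 * Num.sqrt (1 + m ^+ 2) * b * n.+1%:R `^ (- 2^-1).
Proof.
move=> mB tB mg gM b0 Kb Nn.
have n0 : (0 : R) < n.+1%:R by [].
apply: singular_value_le => [|t u t0 ou ku].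
  by rewrite !mulr_ge0 ?sqrtr_ge0 ?powR_ge0// ltW.
have mS := step_kernel_measurable mB mg.
have mKS : jointly_measurable (fun x y : Y => K x y - step_kernel B g x y).
  exact: measurable_funB.
have s2 := bounded_schur mu b0 mKS Kb.
have k2 x : (\int[mu]_y ((K x y - step_kernel B g x y) ^+ 2)%:E <= (b ^+ 2 * m)%:E)%E.
  apply: (@le_trans _ _ (\int[mu]_y (cst (b ^+ 2)%:E y))%E).
    apply: ge0_le_integral => //.
    - by move=> y _; rewrite lee_fin sqr_ge0.
    - apply/measurable_EFinP; apply: measurable_funX.
      exact: jointly_measurable1 mKS x.
    - move=> y _; rewrite lee_fin -real_normK ?num_real// ler_sqr ?nnegrE//.
      exact: ltW.
  by rewrite integral_cst// [leRHS]EFinM fineK ?fin_num_measure.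
(* The Schur part is the zero kernel, but its bound must be positive; this one contributes exactly
   [b ^+ 2] after multiplication by [n + 1]. *)
have e0 : 0 < b / Num.sqrt n.+1%:R / (m + 1) by rewrite !divr_gt0 ?sqrtr_gt0// ltr_wpDl.
have s1 : schur_bound mu (fun _ _ : Y => 0 : R) (b / Num.sqrt n.+1%:R / (m + 1) * (m + 1)).
  apply: bounded_schur => //; first exact: measurable_cst.
  by move=> x y; rewrite normr0 ltW.
have KE : K = (fun x y => step_kernel B g x y +
    (0 + (K x y - step_kernel B g x y))) :> (Y -> Y -> R).
  by apply/funext => x; apply/funext => y; rewrite add0r addrC subrK.
have := singular_value_step mB tB mg gM s1 s2 k2 KE t0 ou ku.
rewrite divfK ?gt_eqF ?ltr_wpDl// exprMn exprVn sqr_sqrtr// => H.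
rewrite -ler_sqr ?nnegrE ?(ltW t0)//; last first.
  by rewrite !mulr_ge0 ?sqrtr_ge0 ?powR_ge0// ltW.
rewrite !exprMn sqr_sqrtr ?addr_ge0 ?sqr_ge0//.
rewrite powRN powR12_sqrt// exprVn sqr_sqrtr//.
rewrite ler_pdivlMr//.
have : t ^+ 2 * (n.+1%:R / 2) <= t ^+ 2 * (n.+1%:R - N%:R).
  by rewrite ler_wpM2l ?sqr_ge0//; lra.
move=> /le_trans/(_ H).
rewrite (_ : n.+1%:R * (b ^+ 2 / n.+1%:R) = b ^+ 2); last by rewrite mulrC divfK.
rewrite (_ : 2 ^+ 2 = 4 :> R); last by ring.
move: (n.+1%:R) => z; move: (b ^+ 2) (t ^+ 2) => b2 t2; lra.
Qed.

(** Chosen so that cells of radius [r] with [r^df = smooth_cst / (n + 1)] number at most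
    [(n + 1) / 2]. *)
Definition smooth_cst := Num.max C 1 * (m + 1) * 2 * 2 `^ df.

(** Truncate at the cell radius [r] itself: the truncation error and the oscillation on a cell are
    then both of order [L * r^eta], where [eta = gamma - df] is positive. *)
Lemma K_singular_value_smooth n : df < gamma ->
  0 <= singular_value (K_operator mu df alpha h) n <=
  (2 * Num.sqrt (1 + m ^+ 2) * (1 + osc_cst) * smooth_cst `^ (eta / df)) * L *
    n.+1%:R `^ (- (eta / df + 2^-1)).
Proof.
move=> dfg; have eta0 : 0 < eta by lra.
have n0 : (0 : R) < n.+1%:R by [].
have Q0 : 0 < smooth_cst.
  by rewrite /smooth_cst !mulr_gt0 ?powR_gt0// ?lt_max ?ltr01 ?orbT// ltr_wpDl.
pose r := (smooth_cst / n.+1%:R) `^ df^-1.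
have r0 : 0 < r by apply: powR_gt0; exact: divr_gt0.
have rdf : r `^ df = smooth_cst / n.+1%:R.
  by rewrite /r -powRrM mulVf ?gt_eqF// powRr1// ltW// divr_gt0.
have reta : r `^ eta = smooth_cst `^ (eta / df) * n.+1%:R `^ (- (eta / df)).
  have e1 : df^-1 * eta = eta / df by rewrite mulrC.
  rewrite /r -powRrM e1 powRM ?(ltW Q0) ?invr_ge0//.
  by rewrite -[in n.+1%:R^-1]powR_inv1// -powRrM mulN1r.
pose b := L * (1 + osc_cst) * r `^ eta.
have b0 : 0 < b.
  apply: mulr_gt0; last exact: powR_gt0.
  by rewrite mulr_gt0// ltr_pwDl.
suff : 0 <= singular_value (K_operator mu df alpha h) n <=
    2 * Num.sqrt (1 + m ^+ 2) * b * n.+1%:R `^ (- 2^-1).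
  move=> /andP[-> /le_trans]; apply.
  rewrite /b reta (opprD (eta / df)) (powRD (x := n.+1%:R)) ?pnatr_eq0 ?implybT//.
  rewrite le_eqVlt; apply/orP; left; apply/eqP; ring.
(* If [r] exceeds the diameter, no cells are needed: the kernel itself is at most [L * r^eta]. *)
have [rX|Xr] := leP r (diam X); last first.
  apply: (@K_singular_value_step r n 0 (fun=> set0) (fun=> cst 0) 0 b) => //.
  - by case.
  - by move=> j y; rewrite normr0.
  - move=> x y; rewrite /step_kernel big_ord0 subr0.
    apply: (le_trans (K_kernel_le x y)).
    rewrite /b -[leRHS]mulrA ler_wpM2l ?(ltW L_gt0)//.
    apply: (@le_trans _ _ (r `^ eta)).
      rewrite ge0_ler_powR ?nnegrE ?mdist_ge0 ?(ltW eta0) ?(ltW r0)//.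
      by rewrite (le_trans (mdist_le_diam X_compact x y))// ltW.
    by rewrite ler_peMl ?powR_ge0// lerDl.
  - by rewrite mulr0 ltW.
have rr : 0 < r <= r by rewrite r0 lexx.
have [N [c [B [mB tB KB NN]]]] := truncated_step rr rX.
apply: (@K_singular_value_step r n N B (fun j => Kd r (c j))
  (L * D `^ beta * r `^ (- s)) b) => //.
- by move=> j; exact: jointly_measurable1 (mKd r) (c j).
- by move=> j y; exact: truncated_kernel_bounded.
- move=> x y.
  rewrite -(subrK (Kd r x y) (K x y)) -addrA (le_trans (ler_normD _ _))//.
  rewrite /b mulrDr mulr1 mulrDl lerD//.
    apply: (le_trans (sub_truncated_kernel_le r x y)).
    case: ifP => [dr|_]; last by rewrite mulr_ge0 ?powR_ge0// ltW.
    rewrite ler_wpM2l ?(ltW L_gt0)// ge0_ler_powR ?nnegrE ?mdist_ge0 ?(ltW eta0) ?(ltW r0)//.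
    exact: ltW.
  apply: (le_trans (KB x y)); rewrite -powRD//.
  by rewrite (gt_eqF r0) implybT.
have C0 : 0 < C by exact: lt_le_trans ltr01 C_ge1.
move: NN; rewrite powRM ?(ltW r0)// rdf.
have -> : 2^-1 `^ df = (2 `^ df)^-1 :> R by rewrite -powR_inv1// -powRrM mulN1r powRN.
rewrite /smooth_cst (max_idPl C_ge1) => NN.
have p0 : 0 < 2 `^ df :> R by exact: powR_gt0.
have m1 : 0 < m + 1 by rewrite ltr_wpDl.
have {}NN : N%:R * ((m + 1) * 2) <= m * n.+1%:R.
  rewrite -ler_pdivrMr//; apply: le_trans NN; rewrite le_eqVlt; apply/orP; left.
  by apply/eqP; field; rewrite ?gt_eqF.
rewrite -(ler_pM2r m1); apply: (@le_trans _ _ (m * n.+1%:R)).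
  by apply: le_trans NN; rewrite le_eqVlt; apply/orP; left; apply/eqP; ring.
by rewrite [leRHS]mulrC ler_wpM2r ?ler0n// lerDl.
Qed.

End kernel_estimates.

(* If [diam X = 0] then the regularity of [mu] says nothing, but [X] is a point
   and the kernel vanishes. *)
Section degenerate.
Context (R : realType) (X : pointedMetricType R).
Variable mu : {finite_measure set (borelType X) -> \bar R}.
Hypothesis X_compact : compact [set: X].

Lemma K_operator_diam0 (df alpha : R) (h : X -> R) : diam X = 0 ->
  compact_operator (K_operator mu df alpha h) /\
  forall n, singular_value (K_operator mu df alpha h) n = 0.
Proof.
move=> d0; have XE (x y : X) : x = y.
  apply: mdist_positivity; apply/eqP; rewrite eq_le mdist_ge0 andbT -d0.
  exact: mdist_le_diam.
have KE : K_kernel df alpha h = (fun _ _ : borelType X => 0).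
  by apply/funext => x; apply/funext => y; rewrite /K_kernel (XE x y) subrr mul0r.
have m1 : 0 < fine (mu setT) + 1 by rewrite ltr_wpDl// fine_ge0.
(* Schur bounds are positive by definition, so the vanishing of the operator is reached through
   arbitrarily small ones. *)
have s0 (e : R) : 0 < e -> schur_bound mu (fun _ _ : borelType X => 0) e.
  move=> e0; rewrite -[e](divfK (lt0r_neq0 m1)); apply: bounded_schur.
  - exact: divr_gt0.
  - exact: measurable_cst.
  - by move=> x y; rewrite normr0 ltW// divr_gt0.
pose B : 'I_0 -> set (borelType X) := fun=> set0.
pose G : 'I_0 -> borelType X -> R := fun=> cst 0.
have mB (j : 'I_0) : measurable (B j) by exact: measurable0.
have tB : trivIset setT B by case.
have mG (j : 'I_0) : measurable_fun setT (G j) by exact: measurable_cst.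
have GM (j : 'I_0) y : `|G j y| <= 0 by rewrite normr0.
have sE : (fun x y => 0 - step_kernel B G x y) = (fun _ _ => 0).
  by apply/funext => x; apply/funext => y; rewrite /step_kernel big_ord0 subr0.
rewrite /K_operator KE; split.
  apply: integral_operator_compact (s0 1 ltr01) _ => e e0.
  by exists 0%N, B, G, 0; split => //; rewrite sE; exact: s0.
move=> n; apply/eqP; rewrite eq_le andbC.
apply: singular_value_le => // t u t0 ou ku.
have := singular_value_sum_dist (e := fun j : 'I_0 => 0) (b := fun=> true)
  (fun _ _ => 0) t0 ou ku.
have oe : partial_orthonormal (fun j : 'I_0 => (0 : L2 mu)) (fun=> true) by case.
move=> /(_ oe); rewrite subr0 big1 => [|i _].
  rewrite pmulr_lle0 ?ltr0n// => t2.
  by have : 0 < t ^+ 2; [rewrite exprn_gt0|rewrite ltNge t2].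
rewrite big_ord0 subr0; apply/eqP; rewrite sqrf_eq0 -normr_le0 normr_id.
apply/ler_addgt0Pl => e e0; rewrite addr0.
apply: (le_trans (integral_operator_norm (s0 _ e0) (u i))).
have /eqP : `|u i| ^+ 2 = 1 by rewrite normL2_sqr ou eqxx.
by rewrite sqrp_eq1// => /eqP ->; rewrite mulr1.
Qed.

End degenerate.

(** * Schatten bounds for the operator *)

Section schatten.
Context (R : realType) (X : pointedMetricType R).
Variable mu : {finite_measure set (borelType X) -> \bar R}.
Variables (df alpha beta : R).
Hypotheses (X_compact : compact [set: X]) (df_gt0 : 0 < df).
Hypothesis mu_regular : ahlfors_regular mu df.
Hypotheses (alpha_gt0 : 0 < 2 * alpha) (alpha_beta : 2 * alpha < beta).
Hypothesis beta_le1 : beta <= 1.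
Local Notation gamma := (beta - 2 * alpha).

Let gamma_gt0 : 0 < gamma. Proof. by rewrite subr_gt0. Qed.

(** The margin [e] gives access to the infimum through nearby bounds and makes the constant positive
    even for constant [h]; it is sent to 0 at the end. *)
Lemma holder_const_bounds (h : X -> R) (e : R) : holder beta h -> 0 < e ->
  0 < holder_const beta h + e /\
  forall x y, `|h x - h y| <= (holder_const beta h + e) * mdist x y `^ beta.
Proof.
move=> hh e0; have hi : has_inf (holder_bounds beta h).
  by split => //; exists 0 => L [].
split; first by rewrite ltr_wpDl// lb_le_inf//; case: hi => // _ _ L [].
have [L [L0 hL] Le] := inf_adherent e0 hi => x y.
by rewrite (le_trans (hL x y))// ler_wpM2r ?powR_ge0// ltW.
Qed.

(** The rate [th] and the constant [W] are fixed before [h], which gives uniformity. The cases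
    [p > 2] and [p <= 2] use the weak and the smooth estimate respectively. *)
Lemma K_operator_decay (p : R) : 1 <= p -> df / gamma < p ->
  2 < p \/ 2 * (df / gamma) < p ->
  exists th : R, 1 < th * p /\ exists2 W : R, 0 < W &
  forall (h : X -> R) (L : R), 0 < L ->
    (forall x y, `|h x - h y| <= L * mdist x y `^ beta) ->
    compact_operator (K_operator mu df alpha h) /\
    forall n, 0 <= singular_value (K_operator mu df alpha h) n <=
      W * L * n.+1%:R `^ (- th).
Proof.
move=> p1 dfp p2; have p0 : 0 < p by lra.
have [C C1 regular] := mu_regular.
have := diam_ge0 X_compact; rewrite le_eqVlt => /predU1P[/esym d0|d0].
  exists 2; split; first by lra.
  exists 1 => // h L L0 _.
  have [cK K0] := K_operator_diam0 mu X_compact df alpha h d0.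
  by split => // n; rewrite K0 lexx mulr_ge0 ?powR_ge0// mul1r ltW.
have dfp' : df / p < gamma.
  by rewrite ltr_pdivrMr// mulrC -ltr_pdivrMr.
have [p_gt2|p_le2] := ltP 2 p.
  (* The lower bound makes the rate [g / df] summable in the power [p]. If [gamma] itself is too
     large, take the midpoint of [df / p] and [df / 2]. *)
  have [g [gp gg gdf]] : exists g, [/\ df / p < g, g <= gamma & 2 * g < df].
    have dp2 : df / p < df / 2 by rewrite ltr_pM2l// ltf_pV2 ?posrE.
    have [gd|dg] := ltP (2 * gamma) df.
      by exists gamma; split.
    by exists ((df / p + df / 2) / 2); split; lra.
  have g0 : 0 < g by apply: lt_trans gp; exact: divr_gt0.
  exists (g / df); split.
    by rewrite mulrAC ltr_pdivlMr// mul1r -ltr_pdivrMr.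
  exists (weak_cst mu df C alpha beta g + 1).
    by rewrite ltr_wpDl// sqrtr_ge0.
  move=> h L L0 hL; split.
    exact: (K_operator_compact X_compact df_gt0 C1 regular d0 alpha_gt0
      alpha_beta beta_le1 L0 hL).
  move=> n; have /andP[-> /le_trans] := K_singular_value_weak X_compact df_gt0 C1
    regular d0 alpha_gt0 alpha_beta L0 hL n g0 gg gdf.
  by apply; rewrite ler_wpM2r ?powR_ge0// ler_wpM2r ?(ltW L0)// lerDl.
have {}p2 : 2 * (df / gamma) < p by case: p2 => //; lra.
have dfg : df < gamma.
  by rewrite -[ltRHS]mul1r -ltr_pdivrMr//; lra.
have t0 : 0 < df / gamma by exact: divr_gt0.
have zE : gamma / df * (df / gamma) = 1 by field; rewrite !gt_eqF.
have z1 : 1 < gamma / df by rewrite ltr_pdivlMr// mul1r.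
have x1 : df / gamma < 1 by rewrite ltr_pdivrMr// mul1r.
pose s := df + 2 * alpha.
exists ((beta - s) / df + 2^-1); split.
  have -> : (beta - s) / df + 2^-1 = gamma / df - 2^-1.
    by rewrite /s; field; rewrite gt_eqF.
  move: zE z1 x1 p2; set z := gamma / df; set x := df / gamma => zE z1 x1 p2.
  (* As [z * x = 1], this product is [2 - x], and [x < 1]. *)
  apply: (@le_lt_trans _ _ ((z - 2^-1) * (2 * x))); first by nra.
  by rewrite ltr_pM2l//; lra.
exists (2 * Num.sqrt (1 + fine (mu setT) ^+ 2) * (1 + (1 + s * 2 `^ (s + 1))) *
    smooth_cst mu df C `^ ((beta - s) / df) + 1).
  have s0 : 0 < s by rewrite addr_gt0.
  by rewrite ltr_wpDl// !mulr_ge0 ?sqrtr_ge0 ?powR_ge0// !addr_ge0// mulr_ge0 ?powR_ge0// ltW.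
  move=> h L L0 hL; split.
    exact: (K_operator_compact X_compact df_gt0 C1 regular d0 alpha_gt0
      alpha_beta beta_le1 L0 hL).
  move=> n; have /andP[-> /le_trans] := K_singular_value_smooth X_compact df_gt0 C1
    regular d0 alpha_gt0 alpha_beta beta_le1 L0 hL n dfg.
  by apply; rewrite ler_wpM2r ?powR_ge0// ler_wpM2r ?(ltW L0)// lerDl.
Qed.

Lemma K_operator_schatten (p : R) : 1 <= p -> df / gamma < p ->
  2 < p \/ 2 * (df / gamma) < p ->
  exists2 C : R, 0 < C & forall h : X -> R, holder beta h ->
    in_schatten p (K_operator mu df alpha h) /\
    (schatten_norm p (K_operator mu df alpha h) <= (C * holder_const beta h)%:E)%E.
Proof.
move=> p1 dfp p2; have [th [thp [W W0 KW]]] := K_operator_decay p1 dfp p2.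
set S := (((1 - 2 `^ (1 - th * p))^-1) `^ p^-1).
have S0 : 0 < S.
  by apply: powR_gt0; rewrite invr_gt0 subr_gt0 powR2_lt1// subr_lt0.
have SW0 : 0 < S * W by exact: mulr_gt0.
exists (S * W) => // h hh.
have normK (e : R) : 0 < e -> (schatten_norm p (K_operator mu df alpha h) <=
    (S * (W * (holder_const beta h + e)))%:E)%E.
  move=> e0; have [L0 hL] := holder_const_bounds hh e0.
  have [_ sK] := KW h _ L0 hL.
  by apply: schatten_norm_decay => //; rewrite mulr_ge0// ltW.
split; first split.
- have [L0 hL] := holder_const_bounds hh ltr01.
  by have [] := KW h _ L0 hL.
- by rewrite (le_lt_trans (normK 1 ltr01))// ltry.
apply/lee_addgt0Pr => e e0.
(* With this margin the excess over [S * W * holder_const beta h] is exactly [e]. *)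
have := normK (e / (S * W)) (divr_gt0 e0 SW0).
move=> /le_trans; apply; rewrite -EFinD lee_fin le_eqVlt; apply/orP; left; apply/eqP.
by field; rewrite !gt_eqF.
Qed.

End schatten.

Theorem proposition2p17 (R : realType) (X : pointedMetricType R)
    (mu : {finite_measure set (borelType X) -> \bar R}) (df alpha beta : R)
    (X_compact : compact [set: X]) (df_gt0 : 0 < df)
    (mu_regular : ahlfors_regular mu df)
    (alpha_gt0 : 0 < 2 * alpha) (alpha_beta : 2 * alpha < beta)
    (beta_le1 : beta <= 1) :
  (forall p : R, 1 <= p ->
     schatten_exponent (Num.ceil (df * beta^-1) + 1) df alpha beta < p ->
     exists2 C : R, 0 < C & forall h : X -> R, holder beta h ->
       in_schatten p (K_operator mu df alpha h) /\
       (schatten_norm p (K_operator mu df alpha h)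
          <= (C * holder_const beta h)%:E)%E) /\
  (2 <= df * (beta - 2 * alpha)^-1 ->
   forall p : R, 1 <= p -> schatten_exponent 1 df alpha beta < p ->
     exists2 C : R, 0 < C & forall h : X -> R, holder beta h ->
       in_schatten p (K_operator mu df alpha h) /\
       (schatten_norm p (K_operator mu df alpha h)
          <= (C * holder_const beta h)%:E)%E).
Proof.
have g0 : 0 < beta - 2 * alpha by rewrite subr_gt0.
have t0 : 0 < df / (beta - 2 * alpha) by exact: divr_gt0.
have b0 : 0 < beta by exact: lt_trans alpha_gt0 alpha_beta.
split=> [p p1|dfg p p1]; rewrite /schatten_exponent -mulrA.
  set l := (_%:~R) => lp.
  (* The ceiling of a positive number is at least 1, so [p] exceeds
     [2 * df / (beta - 2 * alpha)]. *)
  have l2 : 2 <= l.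
    have : (1 <= Num.ceil (df / beta))%R by rewrite -gtz0_ge1 ceil_gt0 divr_gt0.
    rewrite -(lerD2r 1) -(ler_int R); exact.
  have {lp}lp : 2 * (df / (beta - 2 * alpha)) < p.
    by apply: le_lt_trans lp; rewrite ler_wpM2r// ltW.
  apply: K_operator_schatten => //; last by right.
  by lra.
rewrite mul1r => lp; apply: K_operator_schatten => //; left.
exact: le_lt_trans dfg lp.
Qed.
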